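(* For each integer $g \geq 0$ there exists a centrally symmetric map on the orientable surface of genus $g$ with exactly $10g+20$ vertices, all of whose faces are pentagons.
   Context: A surface is a connected, compact 2-manifold without boundary. A map $M$ on a surface $S$ is an embedding in $S$ of a finite simple graph $G$, all of whose vertices have degree $\geq 3$, such that the closures of the components of $S\setminus G$ (called the faces of $M$) are closed 2-cells, i.e. each is homeomorphic to a 2-disk. A map is polyhedral if the intersection of any two distinct faces is either empty, a common vertex, or a common edge. A polyhedral map $M$ is called centrally symmetric if it is invariant under an involution of its vertex set which fixes no face of $M$: the involution is an automorphism of $M$ of order two (mapping vertices, edges and 2-faces to vertices, edges and 2-faces) and no vertex, edge or 2-face is mapped to itself as a set. In particular the number of vertices is even, $2m$, and after labelling the vertices suitably the involution is $(1,2m)(2,2m-1)\cdots(m,m+1)$. *)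

(* Defs.v *)
From mathcomp Require Import all_boot all_order all_algebra.
From mathcomp Require Import all_classical all_reals topology normedtype.

Set Implicit Arguments.
Unset Strict Implicit.
Unset Printing Implicit Defensive.

Import Order.TTheory GRing.Theory Num.Theory.
Import numFieldNormedType.Exports.

Local Open Scope classical_set_scope.
Local Open Scope ring_scope.

(* [{within A, continuous f}] only depends on the restriction of [f] to [A], so
   this is homeomorphism of [A] and [B] for their subspace topologies. *)
Definition homeomorphic_sets (T U : topologicalType) (A : set T) (B : set U) :=
  exists (f : T -> U) (g : U -> T),
    [/\ {within A, continuous f} /\ {within B, continuous g},
        f @` A `<=` B /\ g @` B `<=` A,
        {in A, cancel f g} & {in B, cancel g f}].

(* Second countability is not required: it follows from compactness together
   with the charts. *)
Definition is_surface (R : realType) (S : topologicalType) :=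
  [/\ [set: S] !=set0, hausdorff_space S, compact [set: S],
      connected [set: S]
    & forall x : S, exists (U : set S) (V : set (R * R)),
        [/\ open U, U x, open V & homeomorphic_sets U V]].

Definition closed_2cell (R : realType) (S : topologicalType) (F : set S) :=
  homeomorphic_sets F [set z : R * R | z.1 ^+ 2 + z.2 ^+ 2 <= 1].

(* In a Hausdorff space such a [c] is a homeomorphism from [0, 1] onto [A]. *)
Definition is_arc (R : realType) (S : topologicalType) (x y : S) (A : set S) :=
  exists c : R -> S,
    [/\ {within `[0, 1], continuous c}, {in `[0, 1] &, injective c},
        c 0 = x, c 1 = y & c @` `[0, 1] = A].

(* Embedding of a finite simple graph; [gedge u v] is only meaningful when [u]
   and [v] are adjacent. *)
Record graph_embedding (R : realType) (S : topologicalType) := GraphEmbedding {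
  gvertex : finType;
  gadj : rel gvertex;
  gpos : gvertex -> S;
  gedge : gvertex -> gvertex -> set S;
  gadj_sym : symmetric gadj;
  gadj_irr : irreflexive gadj;
  gpos_inj : injective gpos;
  gedge_sym : forall u v, gadj u v -> gedge u v = gedge v u;
  gedge_arc : forall u v, gadj u v -> is_arc R (gpos u) (gpos v) (gedge u v);
  gedge_pos : forall u v w, gadj u v -> gedge u v (gpos w) -> w = u \/ w = v;
  gedge_meet : forall u v u' v', gadj u v -> gadj u' v' ->
    [set u; v]%SET != [set u'; v']%SET ->
    gedge u v `&` gedge u' v' `<=` range gpos
}.

Section Maps.
Variables (R : realType) (S : topologicalType) (M : graph_embedding R S).
Local Notation V := (gvertex M).

Definition drawing : set S :=
  range (@gpos R S M) `|`
  [set x | exists u v : V, gadj u v /\ gedge u v x].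

Definition faces : set (set S) :=
  [set closure (connected_component (~` drawing) x) | x in ~` drawing].

Definition is_map :=
  (forall v : V, (3 <= #|[set w | gadj v w]%SET|)%N) /\
  (forall F, faces F -> closed_2cell R F).

Definition polyhedral :=
  is_map /\
  forall F F', faces F -> faces F' -> F <> F' ->
    [\/ F `&` F' = set0,
        exists v : V, F `&` F' = [set gpos v]
      | exists u v : V, gadj u v /\ F `&` F' = gedge u v].

(* The boundary [F `&` drawing] of the face [F] is the cycle of the graph
   running through the vertices [c] in this cyclic order. *)
Definition bounded_by (F : set S) (c : seq V) :=
  [/\ ucycle (@gadj R S M) c, (2 < size c)%N
    & F `&` drawing = [set x | exists2 v, v \in c & gedge v (next c v) x]].

Definition facial_cycle (c : seq V) := exists2 F, faces F & bounded_by F c.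

Definition all_faces_pentagons :=
  forall F, faces F -> exists2 c, bounded_by F c & size c = 5%N.

(* Faces are mapped to faces through their boundary cycles.  "Fixed" means
   mapped to itself as a set of vertices. *)
Definition centrally_symmetric :=
  polyhedral /\
  exists s : V -> V,
    [/\ involutive s,
        forall u v, gadj (s u) (s v) = gadj u v
      & forall c, facial_cycle c -> facial_cycle (map s c)] /\
    [/\ forall v, s v != v,
        forall u v, gadj u v -> [set s u; s v]%SET != [set u; v]%SET
      & forall c, facial_cycle c -> ~ (map s c =i c)].

(* The faces can be oriented coherently: [o F] is a direction of travel around
   [F], and no two faces traverse an edge from [u] to [v] in this order, i.e.
   the two faces at an edge induce opposite directions on it. *)
Definition orientable_map :=
  exists o : set S -> seq V,
    (forall F, faces F -> bounded_by F (o F)) /\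
    (forall F F' u, faces F -> faces F' -> u \in o F -> u \in o F' ->
       next (o F) u = next (o F') u -> F = F').

Definition graph_edges : {set {set V}} :=
  [set [set p.1; p.2] | p : V * V & gadj p.1 p.2]%SET.

Definition euler_characteristic (chi : int) :=
  exists2 f : nat, (faces #= `I_f)%card &
    (#|V|%:Z - #|graph_edges|%:Z + f%:Z = chi).

End Maps.

(* Orientability and Euler characteristic do not depend on the map on [S] used
   to compute them. *)
Definition orientable_of_genus (R : realType) (S : topologicalType) (g : nat) :=
  exists N : graph_embedding R S,
    [/\ is_map N, orientable_map N & euler_characteristic N (2 - (2 * g)%N%:Z)].

(* Main.v *)
Require Import Defs.
From mathcomp Require Import all_boot all_order all_algebra.
From mathcomp Require Import all_classical all_reals topology normedtype realfun.
From mathcomp Require Import ring lra zify.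
Set Implicit Arguments.
Unset Strict Implicit.
Unset Printing Implicit Defensive.
Import Order.TTheory GRing.Theory Num.Theory.
Import numFieldNormedType.Exports.
Local Open Scope classical_set_scope.
Local Open Scope ring_scope.

(** Combinatorially, the surface of genus [g] is a dodecahedron with [g] handles.
Suppose given a centrally symmetric map by pentagons in which no face meets its
antipode.  Remove a face and the antipodal face, and glue in a dodecahedron
from which two opposite faces have been removed, the two holes being matched
by maps that commute with the antipodes.  This tube joins two places of one
connected surface, so it is a handle: 10 vertices, 20 edges and 10 faces are
added, 2 faces are removed, and the genus grows by one.  Since the antipode
reverses the orientation, both ends of the tube can be glued compatibly with
the orientation.  The map stays polyhedral, because a face of the tube reaches
only one end of it and has there just one edge of the removed face, so it meets
an old face in no more than the removed face did.  As
opposite faces of a dodecahedron are disjoint, the new faces do not meet their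
antipodes and the construction can be repeated.  The lemmas are
[dodecahedron_antipodal], [attach_tube_antipodal] and [half_faces_antipodal].

Topologically, any finite family of pentagons glued like a surface
([pentagonal_surface]) is realized as follows.  Cone every pentagon from a new
vertex; the space is the set of barycentric coordinate functions carried by a
triangle of the resulting complex, with the topology of pointwise convergence.
It is a closed and bounded part of a power of the reals, hence compact and
Hausdorff.  The link of every vertex is a cycle ([face_link], [vertex_link]), so
its open star has to be mapped onto an open subset of the plane.  Barycentric
coordinates reduce this to identifying the plane with the cone over a cycle of
length [n], which is what a complete fan of [n] plane cones does: a point of the
plane is sent to its coefficients on the two rays that span its cone
([fan_exists]).  The closed star becomes the unit ball of a gauge, which a
radial map carries to the round disc ([cstar_2cell]).  The complement of the
drawn graph is the disjoint union of the open stars of the cone points, so the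
faces are their closures, the closed stars ([component_star], [facesE]).  From
there on the requirements on the map only speak of the supports of barycentric
coordinates, that is, of the pentagons. *)

(** * Complete fans in the plane *)

Section ContinuousFunctions.
Variables (R : realType) (T : topologicalType).
Implicit Types f g : T -> R.

Lemma cont_cst (a : R) : continuous (fun _ : T => a).
Proof. by move=> z; exact: cvg_cst. Qed.

Lemma cont_add f g : continuous f -> continuous g -> continuous (fun z => f z + g z).
Proof. by move=> cf cg z; apply: cvgD; [exact: cf|exact: cg]. Qed.

Lemma cont_sub f g : continuous f -> continuous g -> continuous (fun z => f z - g z).
Proof. by move=> cf cg z; apply: cvgB; [exact: cf|exact: cg]. Qed.

Lemma cont_mul f g : continuous f -> continuous g -> continuous (fun z => f z * g z).
Proof. by move=> cf cg z; apply: cvgM; [exact: cf|exact: cg]. Qed.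

Lemma cont_min f g : continuous f -> continuous g ->
  continuous (fun z => Num.min (f z) (g z)).
Proof. by move=> cf cg z; exact: (@continuous_min R T f g z (cf z) (cg z)). Qed.

Lemma cont_max f g : continuous f -> continuous g ->
  continuous (fun z => Num.max (f z) (g z)).
Proof. by move=> cf cg z; exact: (@continuous_max R T f g z (cf z) (cg z)). Qed.

Lemma cont_sum (I : finType) (f : I -> T -> R) :
  (forall i, continuous (f i)) -> continuous (fun z => \sum_i f i z).
Proof.
move=> cf; apply: continuous_big => // x.
by apply: (@cvgD _ R^o); [exact: cvg_fst|exact: cvg_snd].
Qed.

End ContinuousFunctions.

Section Fan.
Variable R : realType.

(** Coefficients [a 0, ..., a n.-1] vanishing outside two cyclically
consecutive places: the cone over a cycle of length [n]. *)
Definition csupp n (a : nat -> R) :=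
  exists2 j, (j < n)%N & forall i, (i < n)%N -> a i != 0 -> i = j \/ i = (j.+1 %% n)%N.

Definition combi n (p : nat -> R * R) (a : nat -> R) : R * R :=
  (\sum_(i < n) a i * (p i).1, \sum_(i < n) a i * (p i).2).

(** A complete fan of [n] cones with ray generators [p].  The functions
[phi] are the coordinates of a homeomorphism from the plane onto the cone over
an [n]-cycle, with inverse [combi n p]; giving both directions by formulas that
are continuous on the whole space dispenses with angles. *)
Record fan n (p : nat -> R * R) (phi : nat -> R * R -> R) : Prop := Fan {
  fan_cont : forall i, continuous (phi i);
  fan_ge0 : forall i z, 0 <= phi i z;
  fan_supp : forall z, csupp n (phi ^~ z);
  fan_sum : forall z, combi n p (phi ^~ z) = z;
  fan_coef : forall a, (forall i, 0 <= a i) -> csupp n a ->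
    forall i, (i < n)%N -> phi i (combi n p a) = a i }.

(** The rays through (1,0), (0,1) and (-1,-1): the coefficient on the
last one is the least amount that makes both coordinates nonnegative. *)
Lemma fan3 : exists p phi, fan 3 p phi.
Proof.
pose m (z : R * R) : R := Num.min 0 (Num.min z.1 z.2).
have cf : continuous (@fst R R) by move=> z; exact: cvg_fst.
have cs : continuous (@snd R R) by move=> z; exact: cvg_snd.
have cm : continuous m.
  by apply: cont_min; [exact: cont_cst|exact: cont_min].
have mP z : [/\ m z <= 0, m z <= z.1, m z <= z.2
    & [\/ m z = 0, m z = z.1 | m z = z.2]].
  rewrite /m; split; rewrite ?ge_min ?lexx ?orbT //.
  case: (leP 0 (Num.min z.1 z.2)) => _; first by constructor.
  by case: (leP z.1 z.2) => _; [constructor 2|constructor 3].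
pose phi (i : nat) z := match i with 0%N => z.1 - m z | 1%N => z.2 - m z | _ => - m z end.
pose p (i : nat) : R * R := match i with 0%N => (1, 0) | 1%N => (0, 1) | _ => (-1, -1) end.
exists p, phi; split.
- case=> [|[|i]] z; rewrite /phi /=.
  + by apply: cvgB; [exact: cf|exact: cm].
  + by apply: cvgB; [exact: cs|exact: cm].
  + by apply: (@cvgN _ R^o); exact: cm.
- by move=> [|[|i]] z; case: (mP z) => *; rewrite /phi; lra.
- move=> z; have [_ _ _ [] e] := mP z; [exists 0%N|exists 1%N|exists 2%N] => //;
  case=> [|[|[|i]]] // _; rewrite /phi e ?subrr ?oppr0 ?eqxx //=; auto.
- by move=> [x y]; rewrite /combi !big_ord_recl !big_ord0 /phi /=; congr pair; ring.
- move=> a a0 [j j3 aj].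
  have := a0 0%N; have := a0 1%N; have := a0 2%N => a2 a1 a0'.
  have e : [\/ a 0%N = 0, a 1%N = 0 | a 2%N = 0].
    case: j j3 aj => [|[|[|j]]] // _ aj;
      [constructor 3|constructor 1|constructor 2]; apply/eqP; apply: contraT;
      by move=> /aj[]//.
  set z := combi 3 p a.
  have z1 : z.1 = a 0%N - a 2%N by rewrite /z /combi !big_ord_recl big_ord0 /=; ring.
  have z2 : z.2 = a 1%N - a 2%N by rewrite /z /combi !big_ord_recl big_ord0 /=; ring.
  have [+ + + +] := mP z; rewrite z1 z2 => h1 h2 h3 h4.
  have em : m z = - a 2%N by case: e h4 => e [] ?; lra.
  by case=> [|[|[|i]]] // _; rewrite /phi em ?z1 ?z2; lra.
Qed.

(** The cone between the last ray and the first one is subdivided by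
their sum.  Inside it the coefficient of the new ray is the minimum of the two
old ones, and outside it this minimum is zero, so that one formula serves
everywhere. *)
Lemma fanS n p phi : (2 < n)%N -> fan n p phi -> exists p' phi', fan n.+1 p' phi'.
Proof.
move=> n2 [cphi phi0 sphi phiE phiK].
pose mm z := Num.min (phi n.-1 z) (phi 0%N z).
pose phi' i z := if i == n then mm z
  else if (i == 0%N) || (i == n.-1) then phi i z - mm z else phi i z.
pose p' i := if i == n then ((p n.-1).1 + (p 0%N).1, (p n.-1).2 + (p 0%N).2) else p i.
have mm0 z : 0 <= mm z by rewrite le_min !phi0.
have cmm : continuous mm by apply: cont_min; exact: cphi.
(* Replacing the new ray by the sum of its two neighbours. *)
have fold (a : nat -> R) : combi n.+1 p' a =
    combi n p (fun i => if (i == 0%N) || (i == n.-1) then a i + a n else a i).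
  rewrite /combi; have aux (q q' : nat -> R) (qn : q' n = q n.-1 + q 0%N)
    (qq : forall i, (i < n)%N -> q' i = q i) : \sum_(i < n.+1) a i * q' i =
    \sum_(i < n) (if (i == 0 :> nat) || (i == n.-1 :> nat) then a i + a n else a i) * q i.
    rewrite big_ord_recr /= qn.
    have -> : \sum_(i < n) (if (i == 0 :> nat) || (i == n.-1 :> nat) then a i + a n else a i) * q i
      = \sum_(i < n) (a i * q i + (if (i == 0 :> nat) || (i == n.-1 :> nat) then a n * q i else 0)).
      by apply: eq_bigr => i _; case: ifP => _; ring.
    rewrite big_split /=; congr (_ + _).
      by apply: eq_bigr => i _; rewrite qq.
    case: n n2 {sphi phiE phiK phi' p' mm mm0 cmm qn qq} => [|[|n]] // n2.
    rewrite big_ord_recl big_ord_recr /= big1 ?add0r /=.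
      by rewrite /bump /= add1n eqxx addrC -mulrDr.
    by move=> i _; rewrite /bump /= add1n eqSS (ltn_eqF (ltn_ord i)).
  by congr pair; [apply: (aux (fst \o p) (fst \o p'))|apply: (aux (snd \o p) (snd \o p'))];
    rewrite /p' /= ?eqxx // => i i_n; rewrite (ltn_eqF i_n).
exists p', phi'; split.
- move=> i; rewrite /phi'; case: (i == n); first exact: cmm.
  by case: (_ || _); [apply: cont_sub; [exact: cphi|exact: cmm]|exact: cphi].
- move=> i z; rewrite /phi'; case: ifP => // _; case: ifP => // h.
  by rewrite subr_ge0 ge_min; case/orP: h => /eqP->; rewrite lexx ?orbT.
- move=> z; have [j jn hj] := sphi z.
  (* Only the cone of the last and first rays is cut in two. *)
  have [jl|jl] := eqVneq j n.-1.
    have h0 i : (i < n)%N -> i != 0%N -> i != n.-1 -> phi' i z = 0.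
      move=> i_n i0 il; rewrite /phi' (ltn_eqF i_n) (negPf i0) (negPf il) /=.
      apply/eqP; apply: contraT => /hj -/(_ i_n); rewrite jl prednK; last lia.
      by rewrite modnn => -[/eqP|/eqP]; rewrite ?(negPf i0) ?(negPf il).
    have [le|le] := leP (phi n.-1 z) (phi 0%N z).
      exists n; first lia.
      move=> i; rewrite ltnS leq_eqVlt => /orP[/eqP->|i_n]; first by left.
      have [->|i0] := eqVneq i 0%N; first by right; rewrite modnn.
      have [->|il] := eqVneq i n.-1; last by rewrite h0 ?eqxx.
      by rewrite /phi' /mm eqxx orbT (min_idPl le) subrr ltn_eqF ?eqxx //; lia.
    exists n.-1; first lia.
    move=> i; rewrite ltnS leq_eqVlt => /orP[/eqP->|i_n].
      by right; rewrite prednK ?modn_small //; lia.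
    have [->|il] := eqVneq i n.-1; first by left.
    have [->|i0] := eqVneq i 0%N; last by rewrite h0 ?eqxx.
    by rewrite /phi' /mm eqxx (min_idPr (ltW le)) subrr ltn_eqF ?eqxx //; lia.
  have m0 : mm z = 0.
    have : phi n.-1 z = 0 \/ phi 0%N z = 0.
      have [->|h1] := eqVneq (phi n.-1 z) 0; [by left|right].
      apply/eqP; apply: contraT => h2.
      have := hj n.-1 _ h1; have := hj 0%N _ h2.
      rewrite modn_small; last lia.
      by move=> /(_ ltac:(lia)) ? /(_ ltac:(lia)) ?; lia.
    by rewrite /mm => -[]->; [apply/min_idPl|apply/min_idPr].
  exists j; first lia.
  move=> i; rewrite ltnS leq_eqVlt => /orP[/eqP->|i_n]; first by rewrite /phi' eqxx m0 eqxx.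
  rewrite /phi' m0 subr0 if_same (ltn_eqF i_n) => /hj -/(_ i_n).
  by rewrite !modn_small //; lia.
- move=> z; rewrite fold -[RHS]phiE; rewrite /combi.
  have e i : (i < n)%N -> (if (i == 0%N) || (i == n.-1) then phi' i z + phi' n z else phi' i z)
     = phi i z.
    by move=> i_n; rewrite /phi' eqxx (ltn_eqF i_n); case: (_ || _); rewrite // subrK.
  by congr pair; apply: eq_bigr => i _; rewrite e.
- move=> a a0 [j jn hj] i i_n.
  pose b i := if (i == 0%N) || (i == n.-1) then a i + a n else a i.
  have b0 k : 0 <= b k by rewrite /b; case: ifP => _ //; rewrite addr_ge0.
  have ab k : (k < n)%N -> a n = 0 -> b k = a k.
    by rewrite /b => _ ->; rewrite addr0 if_same.
  have main : csupp n b /\ Num.min (b n.-1) (b 0%N) = a n.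
    have [jl|jl] := ltnP j n.-1.
      have an : a n = 0.
        apply/eqP; apply: contraT => /hj -/(_ (ltnSn _)); rewrite modn_small; last lia.
        lia.
      split.
        exists j; first lia.
        move=> k kn; rewrite ab // => /hj -/(_ ltac:(lia)).
        by rewrite !modn_small //; lia.
      rewrite !ab ?an //; try lia.
      have : a n.-1 = 0 \/ a 0%N = 0.
        have [->|h1] := eqVneq (a n.-1) 0; [by left|right].
        apply/eqP; apply: contraT => h2.
        have := hj n.-1 _ h1; have := hj 0%N _ h2.
        rewrite modn_small; last lia.
        by move=> /(_ ltac:(lia)) ? /(_ ltac:(lia)) ?; lia.
      by case=> ->; [apply/min_idPl|apply/min_idPr].
    have az k : (0 < k < n.-1)%N -> a k = 0.
      move=> kn; apply/eqP; apply: contraT => /hj -/(_ ltac:(lia)) [|]; first by lia.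
      have [->|] := eqVneq j n; first by rewrite modnn; lia.
      by move=> ?; rewrite modn_small; lia.
    split.
      exists n.-1; first lia.
      move=> k kn; rewrite prednK; last lia.
      rewrite modnn /b; case: ifP => [/orP[]/eqP|]; [by right|by left|].
      by move=> ?; rewrite az ?eqxx //; lia.
    have b1 : b n.-1 = a n.-1 + a n by rewrite /b eqxx orbT.
    have b2 : b 0%N = a 0%N + a n by rewrite /b eqxx.
    have : a n.-1 = 0 \/ a 0%N = 0.
      have [->|h1] := eqVneq (a n.-1) 0; [by left|right].
      apply/eqP; apply: contraT => h2.
      have := hj n.-1 _ h1; have := hj 0%N _ h2.
      move=> /(_ ltac:(lia)) h3 /(_ ltac:(lia)) h4.
      have [jn'|?] := eqVneq j n.
        by move: h3 h4; rewrite jn' modnn; lia.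
      by move: h3 h4; rewrite modn_small; lia.
    by rewrite b1 b2 => -[]->; rewrite add0r; [apply/min_idPl|apply/min_idPr];
      rewrite lerDr.
  case: main => sb mb; have bK := phiK b b0 sb; rewrite fold -/b.
  have emm : mm (combi n p b) = a n by rewrite /mm !bK //; lia.
  move: i_n; rewrite /phi' ltnS leq_eqVlt => /orP[/eqP->|i_n]; first by rewrite eqxx.
  by rewrite (ltn_eqF i_n) emm bK // /b; case: (_ || _); rewrite // addrK.
Qed.

Lemma fan_exists n : (2 < n)%N -> exists p phi, fan n p phi.
Proof.
elim: n => // n IH; rewrite ltnS leq_eqVlt => /orP[/eqP<-|n2]; first exact: fan3.
by have [p [phi h]] := IH n2; exact: fanS h.
Qed.

End Fan.

(** * Gauges of the plane and radial maps *)

Section Gauge.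
Variable R : realType.
Implicit Types N : R * R -> R.

Definition dilate (c : R) (z : R * R) : R * R := (c * z.1, c * z.2).

(** The properties shared by the Euclidean norm and by the sum of the
coefficients of a fan that make their unit balls homeomorphic. *)
Record gauge N : Prop := Gauge {
  gauge_cont : continuous N;
  gauge_dilate : forall c z, 0 <= c -> N (dilate c z) = c * N z;
  gauge_bound : exists C : R, forall z, `|z.1| <= C * N z /\ `|z.2| <= C * N z;
  gauge_ge0 : forall z, 0 <= N z }.

Lemma dilate_dilate c c' z : dilate c (dilate c' z) = dilate (c * c') z.
Proof. by rewrite /dilate /= !mulrA. Qed.

Lemma dilate1 z : dilate 1 z = z.
Proof. by rewrite /dilate !mul1r; case: z. Qed.

Lemma gauge0 N : gauge N -> N (0, 0) = 0.
Proof.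
move=> gN; have <- : dilate 0 (0, 0) = (0, 0) by rewrite /dilate /= mulr0.
by rewrite gauge_dilate // mul0r.
Qed.

Lemma gauge_eq0 N z : gauge N -> N z = 0 -> z = (0, 0).
Proof.
move=> gN e; have [C /(_ z)] := gauge_bound gN; rewrite e mulr0 !normr_le0.
by case: z {e} => x y /= -[/eqP-> /eqP->].
Qed.

(** Moves each point along its ray so that [N'] takes there the value
that [N] took before.  As division by zero gives zero, the origin is fixed. *)
Definition radial N N' z : R * R := dilate (N z / N' z) z.

Lemma radial_gauge N N' z : gauge N -> gauge N' -> N' (radial N N' z) = N z.
Proof.
move=> gN gN'; rewrite /radial gauge_dilate ?divr_ge0 ?gauge_ge0 //.
have [e|e] := eqVneq (N' z) 0; last by rewrite divfK.
by rewrite e mulr0 (gauge_eq0 gN' e) gauge0.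
Qed.

Lemma radialK N N' z : gauge N -> gauge N' -> radial N' N (radial N N' z) = z.
Proof.
move=> gN gN'; rewrite {1}/radial radial_gauge // {2}/radial dilate_dilate.
rewrite gauge_dilate ?divr_ge0 ?gauge_ge0 //.
have [e|e] := eqVneq (N z) 0.
  by rewrite (gauge_eq0 gN e) /dilate /= !mulr0.
have e' : N' z != 0 by apply: contra_neq e => /(gauge_eq0 gN')->; exact: gauge0.
have -> : N z / (N z / N' z * N z) * (N z / N' z) = 1 by field; rewrite e e'.
by rewrite dilate1.
Qed.

Lemma cont_pair (T : topologicalType) (f g : T -> R) :
  continuous f -> continuous g -> continuous (fun t => (f t, g t) : R * R).
Proof. by move=> cf cg t; exact: (cvg_pair (cf t) (cg t)). Qed.

(** At the origin, where the quotient of the gauges has no limit, the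
coordinates of the image are squeezed by a multiple of [N]. *)
Lemma radial_cont N N' : gauge N -> gauge N' -> continuous (radial N N').
Proof.
move=> gN gN' z; have cN := gauge_cont gN; have cN' := gauge_cont gN'.
have [e|e] := eqVneq (N' z) 0.
  have z0 := gauge_eq0 gN' e; subst z.
  have [C bC] := gauge_bound gN'.
  have cvgN c : c * N z @[z --> ((0, 0) : R * R)] --> (0 : R).
    have : c * N z @[z --> ((0, 0) : R * R)] --> c * N (0, 0).
      by apply: cvgM; [exact: cvg_cst|exact: cN].
    by rewrite gauge0 // mulr0.
  have bd x : (- C) * N x <= (radial N N' x).1 <= C * N x /\
              (- C) * N x <= (radial N N' x).2 <= C * N x.
    have := bC (radial N N' x); rewrite radial_gauge // !ler_norml !mulNr.
    by case.
  have r0 : radial N N' (0, 0) = (0, 0) by rewrite /radial /dilate /= !mulr0.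
  rewrite /continuous_at r0.
  rewrite [radial N N'](_ : _ = fun x => ((radial N N' x).1, (radial N N' x).2)); last first.
    by apply/funext => x; case: (radial _ _ x).
  apply: (cvg_pair (G := nbhs (0 : R)) (H := nbhs (0 : R))).
    apply: (squeeze_cvgr (f := fun x => (- C) * N x) (h := fun x => C * N x)) => //.
    by near=> x; case: (bd x).
  apply: (squeeze_cvgr (f := fun x => (- C) * N x) (h := fun x => C * N x)) => //.
  by near=> x; case: (bd x).
have cq : N x / N' x @[x --> z] --> N z / N' z.
  by apply: cvgM; [exact: cN|apply: (@cvgV R _ (nbhs z) _ N' _ e); exact: cN'].
by apply: (cvg_pair (G := nbhs (N z / N' z * z.1)) (H := nbhs (N z / N' z * z.2)));
  apply: cvgM => //; [exact: cvg_fst|exact: cvg_snd].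
Unshelve. all: by end_near. Qed.

Definition euclid (z : R * R) : R := Num.sqrt (z.1 ^+ 2 + z.2 ^+ 2).

Lemma euclid_gauge : gauge euclid.
Proof.
split.
- move=> z; apply: (@continuous_comp _ _ _ (fun z : R * R => z.1 ^+ 2 + z.2 ^+ 2)
    (@Num.sqrt R)); last exact: sqrt_continuous.
  by apply: cont_add; apply: cont_mul; move=> x; try exact: cvg_fst; exact: cvg_snd.
- move=> c z c0; rewrite /euclid /= !exprMn -mulrDr sqrtrM ?sqr_ge0 //.
  by rewrite sqrtr_sqr ger0_norm.
- exists 1 => z; rewrite mul1r -!sqrtr_sqr /euclid.
  by split; rewrite ler_wsqrtr // ?lerDl ?lerDr sqr_ge0.
- by move=> z; exact: sqrtr_ge0.
Qed.

Lemma euclid_le1 z : (euclid z <= 1) = (z.1 ^+ 2 + z.2 ^+ 2 <= 1).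
Proof.
by rewrite /euclid -[X in _ <= X](@sqrtr1 R) ler_sqrt // ler01.
Qed.

Section FanGauge.
Variables (n : nat) (p : nat -> R * R) (phi : nat -> R * R -> R).
Hypothesis fp : fan n p phi.

Lemma fan_dilate c z i : 0 <= c -> (i < n)%N -> phi i (dilate c z) = c * phi i z.
Proof.
move=> c0 i_n; rewrite -{1}[z](fan_sum fp).
have -> : dilate c (combi n p (phi ^~ z)) = combi n p (fun i => c * phi i z).
  by rewrite /combi /dilate /= !mulr_sumr; congr pair; apply: eq_bigr => k _; rewrite mulrA.
apply: (fan_coef fp) => //; first by move=> k; rewrite mulr_ge0 ?(fan_ge0 fp).
have [j jn hj] := fan_supp fp z; exists j => // k kn; rewrite mulf_eq0 negb_or.
by case/andP=> _; exact: hj.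
Qed.

Definition fan_gauge z := \sum_(i < n) phi i z.

Lemma fan_gaugeP : gauge fan_gauge.
Proof.
split.
- by apply: cont_sum => i; exact: (fan_cont fp).
- by move=> c z c0; rewrite /fan_gauge mulr_sumr; apply: eq_bigr => i _; rewrite fan_dilate.
- exists (\sum_(i < n) (`|(p i).1| + `|(p i).2|)) => z.
  rewrite -{1 3}[z](fan_sum fp) /combi /= /fan_gauge.
  have b i : (i < n)%N -> phi i z <= fan_gauge z.
    move=> i_n; rewrite /fan_gauge (bigD1 (Ordinal i_n)) //= lerDl sumr_ge0 // => k _.
    exact: (fan_ge0 fp).
  split; apply: (le_trans (ler_norm_sum _ _ _)); rewrite mulr_suml; apply: ler_sum => i _.
    rewrite normrM ger0_norm ?(fan_ge0 fp) // mulrC ler_pM ?(fan_ge0 fp) // ?lerDl //.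
    exact: b.
  rewrite normrM ger0_norm ?(fan_ge0 fp) // mulrC ler_pM ?(fan_ge0 fp) // ?lerDr //.
  exact: b.
- by move=> z; apply: sumr_ge0 => i _; exact: (fan_ge0 fp).
Qed.

End FanGauge.
End Gauge.

(** * Geometric realization of a simplicial complex *)

Section Realization.
Variables (R : realType) (W : finType) (K : {set {set W}}).

Definition carried (s : {set W}) (x : W -> R) := forall w, w \notin s -> x w = 0.

Definition polyhedron : set (prod_topology (fun _ : W => R)) :=
  [set x | [/\ forall w, 0 <= x w, \sum_w x w = 1 & exists2 s, s \in K & carried s x]].

Definition realization : topologicalType := set_type polyhedron.
Local Notation S := realization.

Definition bary (x : S) (w : W) : R := (set_val x : W -> R) w.

Lemma baryP x : [/\ forall w, 0 <= bary x w, \sum_w bary x w = 1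
  & exists2 s, s \in K & carried s (bary x)].
Proof. exact: (set_valP x). Qed.

Lemma bary_ge0 x w : 0 <= bary x w. Proof. by case: (baryP x). Qed.
Lemma bary_sum x : \sum_w bary x w = 1. Proof. by case: (baryP x). Qed.
Lemma bary_carried x : exists2 s, s \in K & carried s (bary x).
Proof. by case: (baryP x). Qed.

Lemma bary_le1 x w : bary x w <= 1.
Proof.
rewrite -(bary_sum x) (bigD1 w) //= lerDl sumr_ge0 // => i _; exact: bary_ge0.
Qed.

Lemma bary_inj x y : bary x =1 bary y -> x = y.
Proof. by move=> e; apply: val_inj; apply/funext. Qed.

Definition point (a : W -> R) (Pa : polyhedron a) : S := SigSub (mem_set Pa).

Lemma point_bary a Pa : bary (@point a Pa) = a. Proof. by []. Qed.

(** Compactness apart, this and [continuous_bary] are all that is used of the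
topology of the realization: it is the initial one for the coordinates. *)
Lemma bary_cont w : continuous (bary ^~ w).
Proof.
move=> x; apply: (@continuous_comp _ _ _ (set_val : S -> prod_topology (fun _ : W => R))
  (fun a => a w)); last exact: (@proj_continuous W (fun _ => R) w).
exact: initial_continuous.
Qed.

Lemma continuous_bary (T : topologicalType) (f : T -> S) :
  (forall w, continuous (fun t => bary (f t) w)) -> continuous f.
Proof.
move=> cf; apply: continuous_comp_initial.
move=> t; apply/cvg_sup => w U [V [[A oA <-] fA] VU].
apply: (filterS VU); exact: (cf w t A (open_nbhs_nbhs (conj oA fA))).
Qed.

Lemma realization_hausdorff : hausdorff_space S.
Proof.
move=> x y cxy; apply: bary_inj => w; apply: (@Rhausdorff R) => A B xA yB.
have [z [Az Bz]] := cxy _ _ (bary_cont xA) (bary_cont yB).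
by exists (bary z w).
Qed.

Lemma polyhedron_closed : closed polyhedron.
Proof.
have cw w : continuous (fun a : prod_topology (fun _ : W => R) => a w).
  exact: (@proj_continuous W (fun _ => R) w).
rewrite (_ : polyhedron = (\bigcap_(w in [set: W]) [set a | 0 <= a w])
    `&` [set a | \sum_w a w = 1] `&`
    \bigcup_(s in [set s | s \in K])
      \bigcap_(w in [set w | w \notin s]) [set a | a w = 0]); last first.
  apply/seteqP; split=> a /=.
    by move=> [h1 h2 [s sK h3]]; split; [split=> // w _; exact: h1|exists s].
  by move=> [[h1 h2] [s sK h3]]; split=> //; [move=> w; exact: h1|exists s].
apply: closedI; first apply: closedI.
- apply: closed_bigI => w _.
  by apply: (@preimage_closed _ _ _ [set t : R | 0 <= t]) => [a _|];
    [exact: cw|exact: closed_ge].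
- apply: (@preimage_closed _ _ _ [set t : R | t = 1]) => [a _|];
    [|exact: closed_eq].
  exact: cont_sum.
- apply: closed_bigcup; first exact: finite_finset.
  move=> s _; apply: closed_bigI => w _.
  by apply: (@preimage_closed _ _ _ [set t : R | t = 0]) => [a _|];
    [exact: cw|exact: closed_eq].
Qed.

Lemma polyhedron_compact : compact polyhedron.
Proof.
have box := @tychonoff W (fun _ => R) _ (fun _ => @segment_compact R 0 1).
apply: (subclosed_compact polyhedron_closed box) => a [a0 a1 _] w.
rewrite /= in_itv /= a0 -a1 (bigD1 w) //= lerDl sumr_ge0 // => i _; exact: a0.
Qed.

Lemma realization_compact : compact [set: S].
Proof.
move=> F PF FT.
have Fp : (set_val @ F) polyhedron.
  by apply: (@filterS _ F _ setT) => // x _; exact: set_valP.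
have [a [pa cla]] := polyhedron_compact (fmap_proper_filter _ PF) Fp.
exists (point pa); split=> // A B FA [_ [/= [O oO <-]] Oa OB].
have FA' : (set_val @ F) (set_val @` A) by apply: (@filterS _ F _ A) => // x Ax; exists x.
have [_ [[x Ax <-] Ox]] := cla _ O FA' (open_nbhs_nbhs (conj oO Oa)).
by exists x; split => //; exact: OB.
Qed.

End Realization.

Arguments bary {R W K} x w.

(** * Stars of vertices whose link is a cycle *)

(** Turns [next] on a list into the successor modulo [n] that indexes
the rays of a fan. *)
Lemma next_nth_mod (T : eqType) (x0 : T) (s : seq T) i : uniq s -> (i < size s)%N ->
  next s (nth x0 s i) = nth x0 s (i.+1 %% size s).
Proof.
case: s => // x s us i_s; rewrite next_nth mem_nth // index_uniq //.
move: i_s; rewrite /= ltnS leq_eqVlt => /orP[/eqP->|i_s].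
  by rewrite nth_default // modnn.
by rewrite modn_small // (set_nth_default x).
Qed.

Lemma homeomorphic_total (T U : topologicalType) (A : set T) (B : set U)
    (f : T -> U) (g : U -> T) :
  continuous f -> continuous g ->
  (forall x, A x -> B (f x) /\ g (f x) = x) ->
  (forall z, B z -> A (g z) /\ f (g z) = z) -> homeomorphic_sets A B.
Proof.
move=> cf cg fA gB; exists f, g; split.
- by split; apply: continuous_subspaceT.
- by split=> _ [x xA <-]; [case: (fA x xA)|case: (gB x xA)].
- by move=> x /set_mem /fA[].
- by move=> z /set_mem /gB[].
Qed.

Section Stars.
Variables (R : realType) (W : finType) (K : {set {set W}}).
Local Notation S := (realization R K).

(** The simplices at [w] are the triangles spanned by [w] and two
consecutive members of the cycle [l], up to inclusion. *)
Record is_link (w : W) (l : seq W) : Prop := IsLink {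
  link_uniq : uniq l;
  link_size : (2 < size l)%N;
  link_notin : w \notin l;
  link_cell : forall u, u \in l ->
    exists2 s, s \in K & [set w; u; next l u]%SET \subset s;
  link_cover : forall s, s \in K -> w \in s ->
    exists2 u, u \in l & s \subset [set w; u; next l u]%SET }.

Definition star (w : W) : set S := [set x | 0 < bary x w].
Definition cstar (w : W) : set S :=
  [set x | exists2 s, s \in K & w \in s /\ carried s (bary x)].

Lemma carried_in (s : {set W}) (a : W -> R) v : carried s a -> a v != 0 -> v \in s.
Proof. by move=> h; apply: contraNT => /h->. Qed.

Lemma star_cstar w : star w `<=` cstar w.
Proof.
move=> x xw; have [s sK hs] := bary_carried x; exists s => //; split => //.
by apply: (carried_in hs); rewrite gt_eqF.
Qed.

Lemma star_open w : open (star w).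
Proof.
apply: (@open_comp _ _ _ [set t : R | 0 < t]); last exact: open_gt.
by move=> x _; exact: bary_cont.
Qed.

Section Chart.
Variables (w : W) (l : seq W).
Hypothesis lk : is_link w l.
Variables (p : nat -> R * R) (phi : nat -> R * R -> R).
Hypothesis fp : fan (size l) p phi.
Let n := size l.
Let N := fan_gauge n phi.
Let gN : gauge N := fan_gaugeP fp.
(* Dividing by [cap] leaves the unit ball fixed and retracts the plane onto it,
   which makes the inverse chart a total continuous function. *)
Let cap z := Num.max 1 (N z).

Let cap_gt0 z : 0 < cap z. Proof. by rewrite lt_max ltr01. Qed.

Definition chart (x : S) : R * R := combi n p (fun i => bary x (nth w l i)).

(** The value at the apex [w] makes the coordinates add up to 1. *)
Definition unchart_bary (z : R * R) (v : W) : R :=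
  if v == w then 1 - N z / cap z
  else if v \in l then phi (index v l) z / cap z else 0.

Let sum_link (F : W -> R) : \sum_(v in l) F v = \sum_(i < n) F (nth w l i).
Proof. by rewrite -big_uniq ?(link_uniq lk) //= (big_nth w) big_mkord. Qed.

Let sum_star (F : W -> R) : (forall v, v != w -> v \notin l -> F v = 0) ->
  \sum_v F v = F w + \sum_(i < n) F (nth w l i).
Proof.
move=> F0; rewrite (bigD1 w) //= -sum_link; congr (_ + _).
rewrite (bigID (mem l)) /= [X in _ + X]big1 ?addr0; last first.
  by move=> v /andP[]; exact: F0.
apply: eq_bigl => v; rewrite andb_idl // => vl.
by apply: contraNneq (link_notin lk) => <-.
Qed.

Let nth_neq i : (i < n)%N -> nth w l i != w.
Proof. by move=> ?; apply: contraNneq (link_notin lk) => <-; rewrite mem_nth. Qed.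

Let unchart_nth z i : (i < n)%N -> unchart_bary z (nth w l i) = phi i z / cap z.
Proof.
move=> i_n; rewrite /unchart_bary (negPf (nth_neq i_n)) mem_nth //.
by rewrite index_uniq // (link_uniq lk).
Qed.

Lemma unchart_carried z :
  exists2 s, s \in K & w \in s /\ carried s (unchart_bary z).
Proof.
have [j jn hj] := fan_supp fp z.
have [s sK /fintype.subsetP hs] := link_cell lk (mem_nth w jn).
exists s => //; split; first by apply: hs; rewrite !inE eqxx.
move=> v vs; rewrite /unchart_bary.
have [vw|_] := eqVneq v w.
  by move: vs; rewrite vw hs // !inE eqxx.
case: ifP => // vl; suff -> : phi (index v l) z = 0 by rewrite mul0r.
apply/eqP; apply: contraNT vs => /hj; rewrite index_mem => /(_ vl) e.
apply: hs; rewrite !inE next_nth_mod ?(link_uniq lk) //.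
by case: e => <-; rewrite nth_index // eqxx ?orbT.
Qed.

Lemma unchart_polyhedron z : polyhedron (R := R) K (unchart_bary z).
Proof.
split.
- move=> v; rewrite /unchart_bary; case: eqP => _.
    by rewrite subr_ge0 ler_pdivrMr // mul1r /cap le_max lexx orbT.
  by case: ifP => // _; rewrite divr_ge0 ?(fan_ge0 fp) // ltW.
- rewrite sum_star; last first.
    by move=> v vw vl; rewrite /unchart_bary (negPf vw) (negPf vl).
  rewrite {1}/unchart_bary eqxx (eq_bigr (fun i : 'I_n => phi i z / cap z)).
    by rewrite -mulr_suml subrK.
  by move=> i _; rewrite unchart_nth.
- by have [s sK [_ hs]] := unchart_carried z; exists s.
Qed.

Definition unchart z : S := point (unchart_polyhedron z).

Lemma chart_cont : continuous chart.
Proof.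
by apply: cont_pair; apply: cont_sum => i; apply: cont_mul;
  [exact: bary_cont|exact: cont_cst|exact: bary_cont|exact: cont_cst].
Qed.

Lemma unchart_cont : continuous unchart.
Proof.
have ccap : continuous (fun z => (cap z)^-1).
  move=> z; apply: (@cvgV R _ (nbhs z) _ cap); first by rewrite gt_eqF.
  by apply: cont_max; [exact: cont_cst|exact: gauge_cont].
apply: continuous_bary => v.
rewrite (_ : (fun z => _) = unchart_bary^~ v) // /unchart_bary.
case: (v == w).
  by apply: cont_sub; [exact: cont_cst|apply: cont_mul; [exact: gauge_cont|]].
case: (v \in l); last exact: cont_cst.
by apply: cont_mul => //; exact: (fan_cont fp).
Qed.

Lemma chart_coef x i : cstar w x -> (i < n)%N ->
  phi i (chart x) = bary x (nth w l i).
Proof.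
move=> [s sK [ws hs]] i_n.
apply: (fan_coef fp) => // [j|]; first exact: bary_ge0.
have [u ul /fintype.subsetP su] := link_cover lk sK ws.
exists (index u l); first by rewrite index_mem.
move=> k kn /(carried_in hs)/su; rewrite !inE (negPf (nth_neq kn)) /=.
rewrite -{2}(nth_index w ul) next_nth_mod ?index_mem ?(link_uniq lk) //.
case/orP=> /eqP e; [left|right].
  by rewrite -e index_uniq // (link_uniq lk).
apply/eqP; rewrite -(nth_uniq w kn _ (link_uniq lk)) ?e //.
by rewrite ltn_mod (leq_trans _ (link_size lk)).
Qed.

Lemma chart_gauge x : cstar w x -> N (chart x) = 1 - bary x w.
Proof.
move=> xw; have [s sK [ws hs]] := xw; rewrite /N /fan_gauge.
rewrite (eq_bigr (fun i : 'I_n => bary x (nth w l i))); last first.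
  by move=> i _; rewrite chart_coef.
rewrite -(bary_sum x) sum_star; first by rewrite addrAC subrr add0r.
move=> v vw vl; apply: hs; apply/negP => vs.
have [u ul /fintype.subsetP su] := link_cover lk sK ws.
move: (su v vs); rewrite !inE (negPf vw) /= => /orP[]/eqP e; move: vl; rewrite e ?ul //.
by rewrite mem_next ul.
Qed.

Lemma chartK x : cstar w x -> unchart (chart x) = x.
Proof.
move=> xw; apply: bary_inj => v; rewrite point_bary /unchart_bary.
have cap1 : cap (chart x) = 1.
  by apply/max_idPl; rewrite chart_gauge // gerBl bary_ge0.
rewrite cap1 !divr1 chart_gauge // opprB addrC subrK.
case: eqP => [->//|/eqP vw]; case: ifP => [vl|/negbT vl].
  by rewrite chart_coef ?index_mem // nth_index.
have [s sK [ws hs]] := xw.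
apply/esym; apply: hs; apply/negP => vs.
have [u ul /fintype.subsetP su] := link_cover lk sK ws.
move: (su v vs); rewrite !inE (negPf vw) /= => /orP[]/eqP e; move: vl; rewrite e ?ul //.
by rewrite mem_next ul.
Qed.

Lemma unchartK z : N z <= 1 -> chart (unchart z) = z.
Proof.
move=> z1; have cap1 : cap z = 1 by apply/max_idPl.
rewrite -[RHS](fan_sum fp) /chart /combi; congr pair; apply: eq_bigr => i _;
  by rewrite point_bary unchart_nth // cap1 divr1.
Qed.

End Chart.

(** The closed star is the unit ball of a gauge, and [1 - N] is the
coordinate at the apex; the open star is therefore the open unit ball. *)
Lemma star_coordinates w l : is_link w l ->
  exists N (f : S -> R * R) (g : R * R -> S),
  [/\ gauge N, continuous f, continuous g,
      forall x, cstar w x -> g (f x) = x /\ N (f x) = 1 - bary x w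
    & forall z, N z <= 1 -> f (g z) = z /\ cstar w (g z)].
Proof.
move=> lk; have [p [phi fp]] := @fan_exists R _ (link_size lk).
exists (fan_gauge (size l) phi), (chart w l p), (unchart lk fp); split.
- exact: fan_gaugeP fp.
- exact: chart_cont.
- exact: unchart_cont.
- by move=> x xw; rewrite chartK // chart_gauge.
- by move=> z z1; split; [exact: unchartK|exact: (unchart_carried lk fp z)].
Qed.

Section LinkedStar.
Variables (w : W) (l : seq W).
Hypothesis lk : is_link w l.

Lemma star_plane : exists V : set (R * R), open V /\ homeomorphic_sets (star w) V.
Proof.
have [N [f [g [gN cf cg fP gP]]]] := star_coordinates lk.
exists [set z | N z < 1]; split.
  apply: (@open_comp _ _ _ [set t : R | t < 1]); last exact: open_lt.
  by move=> x _; exact: gauge_cont.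
apply: (homeomorphic_total cf cg) => [x xw|z z1].
  have [gf Nf] := fP _ (star_cstar xw); split=> //.
  by rewrite /= Nf gtrBl.
have [fg gw] := gP _ (ltW z1); split=> //; have [_] := fP _ gw.
by rewrite fg /star /= => e; have : N z < 1 by []; lra.
Qed.

Lemma cstar_2cell : closed_2cell R (cstar w).
Proof.
have [N [f [g [gN cf cg fP gP]]]] := star_coordinates lk.
pose r := radial N (@euclid R); pose r' := radial (@euclid R) N.
have gE := euclid_gauge R.
apply: (@homeomorphic_total _ _ _ _ (r \o f) (g \o r')).
- by move=> x; apply: continuous_comp; [exact: cf|exact: radial_cont].
- by move=> x; apply: continuous_comp; [exact: radial_cont|exact: cg].
- move=> x xw; have [gf Nf] := fP _ xw; rewrite /= /r /r' radialK // gf; split=> //.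
  have : euclid (radial N (@euclid R) (f x)) <= 1.
    by rewrite radial_gauge // Nf gerBl bary_ge0.
  by rewrite euclid_le1.
- move=> z zD; have z1 : euclid z <= 1 by rewrite euclid_le1.
  have [|fg gw] := gP (r' z); first by rewrite radial_gauge.
  by split=> //; rewrite /= fg /r /r' radialK.
Qed.

(** A ray from a point of the closed star to the apex runs inside the open
star as soon as it has left its origin; connectedness of the open star and the
determination of its closure both come from this. *)
Lemma cstar_ray x : cstar w x ->
  exists c : R -> S, [/\ continuous c, c 0 = x,
    forall t, 0 <= t -> t <= 1 -> t <= bary (c t) w & bary (c 1) w = 1].
Proof.
move=> xw; have [N [f [g [gN cf cg fP gP]]]] := star_coordinates lk.
have [gf Nf] := fP _ xw.
have c0 (t : R) : 0 <= t -> t <= 1 -> N (dilate (1 - t) (f x)) <= 1 - t.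
  move=> t0 t1; rewrite gauge_dilate ?subr_ge0 // Nf ler_piMr ?subr_ge0 //.
  by rewrite gerBl bary_ge0.
have ge_t t : 0 <= t -> t <= 1 -> t <= bary (g (dilate (1 - t) (f x))) w.
  move=> t0 t1; have [|fg gw] := gP (dilate (1 - t) (f x)).
    by apply: (le_trans (c0 _ t0 t1)); rewrite gerBl.
  by have [_ e] := fP _ gw; move: (c0 _ t0 t1); rewrite fg in e; rewrite e; lra.
exists (fun t => g (dilate (1 - t) (f x))); split=> //.
- have cd : continuous (fun t : R => dilate (1 - t) (f x)).
    apply: cont_pair; apply: cont_mul; try exact: cont_cst;
    by apply: cont_sub; [exact: cont_cst|move=> ?; exact: cvg_id].
  by move=> t; exact: (continuous_comp (cd t) (cg _)).
- by rewrite subr0 dilate1.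
- by apply/le_anti; rewrite bary_le1 ge_t ?ler01.
Qed.

Lemma bary_apex (x y : S) : bary x w = 1 -> bary y w = 1 -> x = y.
Proof.
have h (z : S) v : bary z w = 1 -> v != w -> bary z v = 0.
  move=> zw vw; have := bary_sum z; rewrite (bigD1 w) //= zw (bigD1 v) //=.
  have := bary_ge0 z v.
  have : 0 <= \sum_(i | (i != w) && (i != v)) bary z i.
    by apply: sumr_ge0 => i _; exact: bary_ge0.
  lra.
move=> xw yw; apply: bary_inj => v; have [->|vw] := eqVneq v w; first by rewrite xw yw.
by rewrite (h x v xw vw) (h y v yw vw).
Qed.

Lemma star_connected : connected (star w).
Proof.
have toapex x : star w x ->
    exists C, [/\ connected C, C x, C `<=` star w & exists2 a, C a & bary a w = 1].
  move=> xw; have [c [cc c0 cs c1]] := cstar_ray (star_cstar xw).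
  exists (c @` `[0, 1]); split.
  - by apply: connected_continuous_connected;
      [exact: segment_connected|exact: continuous_subspaceT].
  - by exists 0 => //=; rewrite in_itv /= lexx ler01.
  - move=> _ [t + <-]; rewrite /= in_itv /= => /andP[t0 t1].
    have [t00|t00] := ltP 0 t; first exact: lt_le_trans t00 (cs _ t0 t1).
    by have -> : t = 0 by [lra]; rewrite /star /= c0.
  - by exists (c 1) => //; exists 1 => //=; rewrite in_itv /= lexx ler01.
have [->|/set0P [x0 x0w]] := eqVneq (star w) set0; first exact: connected0.
have [C0 [_ _ C0s [a C0a a1]]] := toapex _ x0w.
suff -> : star w = connected_component (star w) a by exact: component_connected.
apply/seteqP; split; last exact: connected_component_sub.
move=> x xw; have [C [cC Cx Cs [b Cb b1]]] := toapex _ xw.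
by rewrite (bary_apex b1 a1) in Cb; exact: (connected_component_max Cb Cs cC).
Qed.

Lemma cstar_closed : closed (cstar w).
Proof.
rewrite (_ : cstar w = \bigcup_(s in [set s | (s \in K) && (w \in s)])
      \bigcap_(v in [set v | v \notin s]) [set x | bary x v = 0]); last first.
  apply/seteqP; split=> x.
    by move=> [s sK [ws hs]]; exists s => //=; rewrite sK ws.
  by move=> [s /= /andP[sK ws] hs]; exists s.
apply: closed_bigcup; first exact: finite_finset.
move=> s _; apply: closed_bigI => v _.
by apply: (@preimage_closed _ _ _ [set t : R | t = 0]) => [x _|];
  [exact: bary_cont|exact: closed_eq].
Qed.

Lemma closure_star : closure (star w) = cstar w.
Proof.
apply/seteqP; split.
  by rewrite (closure_id (cstar w)).1; [apply: closure_subset;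
    exact: star_cstar|exact: cstar_closed].
move=> x xw B Bx; have [c [cc c0 cs _]] := cstar_ray xw.
have : nbhs (0 : R) (c @^-1` B) by apply: cc; rewrite c0.
move=> /nbhs_ballP[e /= e0 eB].
(* Any small positive time gives a point of the open star in [B]. *)
pose t := Num.min (e / 2) 1.
have t0 : 0 < t by rewrite lt_min divr_gt0 //= ltr01.
have t1 : t <= 1 by rewrite ge_min lexx orbT.
exists (c t); split; first exact: lt_le_trans t0 (cs _ (ltW t0) t1).
apply: eB; rewrite /ball /= sub0r normrN gtr0_norm //.
by rewrite (@le_lt_trans _ _ (e / 2)) ?ge_min ?lexx // ltr_pdivrMr // ltr_pMr // ltr1n.
Qed.

End LinkedStar.
End Stars.

(** * Straight edges *)

Section Segments.
Variables (R : realType) (W : finType) (K : {set {set W}}).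
Local Notation S := (realization R K).
Hypothesis Kcover : forall w, exists2 s, s \in K & w \in s.

Definition segment_bary (w w' : W) (t : R) (v : W) : R :=
  (1 - t) * (v == w)%:R + t * (v == w')%:R.

Lemma segment_polyhedron w w' t s : s \in K -> w \in s -> w' \in s ->
  0 <= t <= 1 -> polyhedron (R := R) K (segment_bary w w' t).
Proof.
move=> sK ws ws' /andP[t0 t1]; split.
- by move=> v; rewrite addr_ge0 // mulr_ge0 ?ler0n // subr_ge0.
- have d (u : W) : \sum_v (v == u)%:R = 1 :> R.
    by rewrite (bigD1 u) //= eqxx big1 ?addr0 // => i /negPf->.
  by rewrite big_split /= -!mulr_sumr !d; ring.
- exists s => // v vs; rewrite /segment_bary.
  have [e|_] := eqVneq v w; first by rewrite e ws in vs.
  have [e|_] := eqVneq v w'; first by rewrite e ws' in vs.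
  by rewrite !mulr0 addr0.
Qed.

Lemma vertex_polyhedron w : polyhedron (R := R) K (segment_bary w w 0).
Proof.
by have [s sK ws] := Kcover w; apply: (segment_polyhedron sK) => //; rewrite lexx ler01.
Qed.

(** A vertex is the degenerate segment from itself to itself. *)
Definition vpoint w : S := point (vertex_polyhedron w).

Lemma bary_vpoint w v : bary (vpoint w) v = (v == w)%:R.
Proof. by rewrite point_bary /segment_bary subr0 mul1r mul0r addr0. Qed.

Lemma vpoint_inj : injective vpoint.
Proof.
move=> u v /(congr1 (bary ^~ u)); rewrite !bary_vpoint eqxx.
by have [//|_ /eqP] := eqVneq u v; rewrite oner_eq0.
Qed.

Lemma carried_vpoint (s : {set W}) w : carried s (bary (vpoint w)) <-> w \in s.
Proof.
split=> [h|ws v vs]; first by apply: (carried_in h); rewrite bary_vpoint eqxx oner_eq0.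
by rewrite bary_vpoint; case: eqP vs => // ->; rewrite ws.
Qed.

Lemma carried_set1 (x : S) w : carried [set w]%SET (bary x) -> x = vpoint w.
Proof.
move=> h; have w1 : bary x w = 1.
  rewrite -(bary_sum x) (bigD1 w) //= big1 ?addr0 // => v vw.
  by rewrite h // inE.
apply: bary_inj => v; rewrite bary_vpoint; have [->|vw] := eqVneq v w.
  exact: w1.
by rewrite h // inE.
Qed.

Lemma carried_subset (s s' : {set W}) (a : W -> R) : s \subset s' ->
  carried s a -> carried s' a.
Proof. by move=> /fintype.subsetP ss h v vs; apply: h; apply: contra vs; exact: ss. Qed.

Lemma segment_arc w w' s : s \in K -> w \in s -> w' \in s -> w != w' ->
  is_arc R (vpoint w) (vpoint w') [set x : S | carried [set w; w']%SET (bary x)].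
Proof.
move=> sK ws ws' nw.
(* Clamping the parameter makes the segment a total function. *)
pose cl (t : R) := Num.max 0 (Num.min t 1).
have cl01 t : 0 <= cl t <= 1.
  by rewrite /cl le_max lexx /= ge_max ler01 ge_min lexx orbT.
have clE t : 0 <= t <= 1 -> cl t = t.
  by move=> /andP[t0 t1]; rewrite /cl (min_idPl t1); apply/max_idPr.
have ccl : continuous cl.
  apply: cont_max; first exact: cont_cst.
  by apply: cont_min; [move=> ?; exact: cvg_id|exact: cont_cst].
pose c t : S := point (segment_polyhedron sK ws ws' (cl01 t)).
have cE t v : bary (c t) v = segment_bary w w' (cl t) v by rewrite point_bary.
have bw t : 0 <= t <= 1 -> bary (c t) w' = t.
  move=> /clE t01; rewrite cE /segment_bary eqxx eq_sym (negPf nw) t01.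
  by rewrite mulr0 add0r mulr1.
have z01 : 0 <= (0 : R) <= 1 by rewrite lexx ler01.
have o01 : 0 <= (1 : R) <= 1 by rewrite lexx ler01.
exists c; split.
- apply: continuous_subspaceT; apply: continuous_bary => v.
  rewrite (_ : (fun t => _) = (fun t => segment_bary w w' (cl t) v)); last first.
    by apply/funext => t; exact: cE.
  apply: cont_add; apply: cont_mul; try exact: cont_cst; last exact: ccl.
  by apply: cont_sub; [exact: cont_cst|exact: ccl].
- move=> t t' t1 t2 /(congr1 (bary ^~ w')).
  by rewrite !in_itv /= in t1 t2; rewrite (bw _ t1) (bw _ t2).
- apply: bary_inj => v; rewrite bary_vpoint cE /segment_bary (clE _ z01).
  by rewrite subr0 mul1r mul0r addr0.
- apply: bary_inj => v; rewrite bary_vpoint cE /segment_bary (clE _ o01).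
  by rewrite subrr mul0r mul1r add0r.
- apply/seteqP; split=> [_ [t _ <-] v|x hx].
    rewrite cE /segment_bary !inE negb_or => /andP[/negPf-> /negPf->].
    by rewrite !mulr0 addr0.
  have h01 : 0 <= bary x w' <= 1 by rewrite bary_ge0 bary_le1.
  exists (bary x w'); first by rewrite /= in_itv.
  apply: bary_inj => v; rewrite cE /segment_bary (clE _ h01).
  have e : bary x w = 1 - bary x w'.
    rewrite -(bary_sum x) (bigD1 w) //= (bigD1 w') 1?eq_sym //= big1 ?addr0 ?addrK //.
    by move=> i /andP[i1 i2]; rewrite hx // !inE negb_or i1.
  have [->|vw] := eqVneq v w; first by rewrite (negPf nw) e mulr1 mulr0 addr0.
  have [->|vw'] := eqVneq v w'; first by rewrite mulr0 add0r mulr1.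
  by rewrite !mulr0 addr0 hx // !inE negb_or vw.
Qed.

End Segments.

(** * Combinatorial pentagonal surfaces and the links of their cone subdivision *)

Section CyclicSequences.
Variable T : eqType.
Implicit Type c : seq T.

Definition dart c : rel T := fun u v => (u \in c) && (next c u == v).

Lemma dart_mem c u v : dart c u v -> u \in c /\ v \in c.
Proof. by case/andP=> uc /eqP <-; rewrite mem_next uc. Qed.

Lemma dart_next c u : u \in c -> dart c u (next c u).
Proof. by move=> uc; rewrite /dart uc eqxx. Qed.

Lemma dart_prev c u : uniq c -> u \in c -> dart c (prev c u) u.
Proof. by move=> Uc uc; rewrite /dart mem_prev uc next_prev ?eqxx. Qed.

Lemma dart_inj c u u' v : uniq c -> dart c u v -> dart c u' v -> u = u'.
Proof.
by move=> Uc /andP[_ /eqP<-] /andP[_ /eqP /(congr1 (prev c))]; rewrite !prev_next.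
Qed.

(** Writes a pentagon from a chosen vertex on, so that facts on [next] become
computations on five distinct points. *)
Lemma pentagon_at c u : uniq c -> size c = 5 -> u \in c ->
  exists a b d e, [/\ uniq [:: u; a; b; d; e], c =i [:: u; a; b; d; e]
    & next c =1 next [:: u; a; b; d; e]].
Proof.
move=> Uc c5 uc; have [i c' ec] := rot_to uc.
have : size (u :: c') = 5 by rewrite -ec size_rot.
case: c' ec => [|a [|b [|d [|e [|]]]]] // ec _.
exists a, b, d, e; rewrite -ec; split; first by rewrite rot_uniq.
  by move=> x; rewrite mem_rot.
by move=> x; rewrite next_rot.
Qed.

Lemma pentagon_next2 c u : uniq c -> size c = 5 -> u \in c -> next c (next c u) != u.
Proof.
move=> Uc c5 uc; have [a [b [d [e [U _ E]]]]] := pentagon_at Uc c5 uc.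
move: U; rewrite !E /= !inE !negb_or -!andbA eqxx.
case/and5P=> n1 n2 n3 n4 _.
by rewrite (eq_sym a) (negPf n1) eqxx eq_sym.
Qed.

(** Of three pairwise adjacent vertices of a cycle, one lies
between the other two; these are then at distance two along the cycle, and in a
pentagon they are not adjacent. *)
Lemma pentagon_no_triangle c u v w : uniq c -> size c = 5 ->
  u != v -> dart c u v || dart c v u -> u != w -> dart c u w || dart c w u ->
  v != w -> dart c v w || dart c w v -> False.
Proof.
move=> Uc c5.
have main x y z : dart c x y -> dart c z x -> dart c y z || dart c z y -> False.
  move=> xy zx; have [xc _] := dart_mem xy; have [zc _] := dart_mem zx.
  have [a [b [d [e [U M E]]]]] := pentagon_at Uc c5 xc.
  move: U; rewrite /= !inE !negb_or -!andbA => /and5P[n1 n2 n3 n4].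
  case/and5P=> n5 n6 n7 n8 /andP[n9 /andP[n10 _]].
  have ya : y = a by move: xy => /andP[_]; rewrite E /= eqxx => /eqP.
  have ze : z = e.
    apply: (dart_inj Uc zx); rewrite /dart M !inE eqxx !orbT E /=.
    rewrite (eq_sym e) (negPf n4) (eq_sym e) (negPf n7) (eq_sym e) (negPf n9).
    by rewrite (eq_sym e) (negPf n10) eqxx.
  have za : z != y by rewrite ze ya eq_sym.
  case/orP=> [|/andP[_ /eqP]].
    rewrite /dart E ya ze /= (eq_sym a x) (negPf n1) eqxx => /andP[_ /eqP eb].
    by rewrite eb eqxx in n9.
  move: zx => /andP[_ /eqP ->] exy; move: n1; rewrite -ya -exy eqxx //.
move=> uv h1 uw h2 vw h3.
have P3 x y z : y != z -> dart c x y -> dart c x z -> False.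
  by move=> yz /andP[_ /eqP e] /andP[_ /eqP e']; rewrite -e -e' eqxx in yz.
have Q3 x y z : y != z -> dart c y x -> dart c z x -> False.
  by move=> yz d1 d2; move: yz; rewrite (dart_inj Uc d1 d2) eqxx.
case/orP: h1 => h1; case/orP: h2 => h2.
- exact: P3 vw h1 h2.
- exact: main h1 h2 h3.
- by apply: (main _ _ _ h2 h1); rewrite orbC.
- exact: Q3 vw h1 h2.
Qed.

(** The shape of the link of a vertex in the cone subdivision: around the
vertex, cone points of faces alternate with neighbours in the graph. *)
Definition interleave (U : Type) (a b : T -> U) (o : seq T) :=
  flatten [seq [:: a f; b f] | f <- o].

Lemma size_interleave U a b o : size (@interleave U a b o) = (2 * size o)%N.
Proof. by elim: o => //= x o IH; rewrite -/(interleave _ _ _) IH; lia. Qed.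

Lemma nth_interleave U a b o x0 t0 i : (i < size o)%N ->
  nth x0 (@interleave U a b o) (2 * i) = a (nth t0 o i) /\
  nth x0 (interleave a b o) (2 * i).+1 = b (nth t0 o i).
Proof.
elim: o i => [//|x o IH] [_ //|i i_o]; have [h1 h2] := IH i i_o.
by rewrite (_ : (2 * i.+1)%N = (2 * i).+2) //; lia.
Qed.

Lemma mem_interleave (U : eqType) (a b : T -> U) o x :
  x \in interleave a b o -> exists2 f, f \in o & x = a f \/ x = b f.
Proof.
move=> /flattenP[_ /mapP[f fo ->]]; rewrite !inE => /orP[]/eqP->; exists f; auto.
Qed.

Lemma interleave_mem (U : eqType) (a b : T -> U) o f : f \in o ->
  a f \in interleave a b o /\ b f \in interleave a b o.
Proof.
by move=> fo; split; apply/flattenP; exists [:: a f; b f];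
  rewrite ?inE ?eqxx ?orbT //; apply/mapP; exists f.
Qed.

Lemma perm_interleave (U : eqType) (a b : T -> U) o :
  perm_eq (interleave a b o) (map a o ++ map b o).
Proof.
elim: o => //= x o IH; rewrite perm_cons -[b x :: map b o]cat1s perm_sym perm_catCA /=.
by rewrite perm_cons perm_sym.
Qed.

Lemma next_interleave (U : eqType) (a b : T -> U) o f :
  uniq o -> uniq (interleave a b o) -> f \in o ->
  next (interleave a b o) (a f) = b f /\ next (interleave a b o) (b f) = a (next o f).
Proof.
move=> Uo Ui fo; have fi : (index f o < size o)%N by rewrite index_mem.
have [h1 h2] := nth_interleave a b (a f) f fi; rewrite !nth_index // in h1 h2.
have sz := size_interleave a b o.
have e1 := next_nth_mod (a f) Ui.
split.
  rewrite -{1}h1 e1 sz ?modn_small ?h2 //; lia.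
rewrite -{1}h2 e1 sz; last lia.
have -> : ((2 * index f o).+2 = 2 * (index f o).+1)%N by lia.
rewrite -muln_modr.
have lm : ((index f o).+1 %% size o < size o)%N by rewrite ltn_mod; lia.
have [-> _] := nth_interleave a b (a f) f lm.
by rewrite -next_nth_mod // nth_index.
Qed.

End CyclicSequences.

(** Pentagons, oriented coherently, glued to a connected closed
surface so that two of them share at most a vertex or an edge.  The darts
[u, v] are the oriented edges.  Connectedness of the graph, and of the ring of
faces around a vertex (which excludes pinched points), are stated as induction
principles: a property passed on between neighbours holds for all as soon as it
holds for one. *)
Record pentagonal_surface (V F : finType) (cyc : F -> seq V) : Prop := PentagonalSurface {
  ps_uniq : forall f, uniq (cyc f);
  ps_size : forall f, size (cyc f) = 5;
  ps_orient : forall f f' u v, dart (cyc f) u v -> dart (cyc f') u v -> f = f';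
  ps_rev : forall f u v, dart (cyc f) u v -> exists f', dart (cyc f') v u;
  ps_link : forall (v : V) (P : F -> Prop),
    (forall f f' u, dart (cyc f) u v -> dart (cyc f') v u -> P f <-> P f') ->
    forall f f', v \in cyc f -> v \in cyc f' -> P f -> P f';
  ps_connected : forall P : V -> Prop,
    (forall f u v, dart (cyc f) u v -> P u -> P v) -> forall u v, P u -> P v;
  ps_meet : forall f f' u v, f != f' -> u != v -> u \in cyc f -> v \in cyc f ->
    u \in cyc f' -> v \in cyc f' -> dart (cyc f) u v || dart (cyc f) v u;
  ps_degree : forall v, (2 < #|[set w | [exists f, dart (cyc f) v w]]%SET|)%N }.

Section PentagonalSurface.
Variables (R : realType) (V F : finType) (cyc : F -> seq V).
Hypothesis ps : pentagonal_surface cyc.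
Local Notation W := (V + F)%type.

Lemma ps_cover v : exists f, v \in cyc f.
Proof.
have /card_gt0P[w] : (0 < #|[set w | [exists f, dart (cyc f) v w]]%SET|)%N.
  exact: leq_trans (ps_degree ps v).
by rewrite inE => /existsP[f /dart_mem[vf _]]; exists f.
Qed.

Definition cone_cell (f : F) (u : V) : {set W} :=
  [set inr f; inl u; inl (next (cyc f) u)]%SET.

Definition cone_complex : {set {set W}} :=
  [set cone_cell p.1 p.2 | p : F * V & p.2 \in cyc p.1]%SET.

Local Notation S := (realization R cone_complex).

Lemma cone_complexP s : reflect (exists f u, u \in cyc f /\ s = cone_cell f u)
  (s \in cone_complex).
Proof.
apply: (iffP imsetP) => [[[f u]]|[f [u [uf ->]]]].
  by rewrite inE /= => uf ->; exists f, u.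
by exists (f, u); rewrite ?inE.
Qed.

Lemma cone_cell_in f u : u \in cyc f -> cone_cell f u \in cone_complex.
Proof. by move=> uf; apply/cone_complexP; exists f, u. Qed.

Lemma cone_cover w : exists2 s, s \in cone_complex & w \in s.
Proof.
case: w => [v|f].
  have [f vf] := ps_cover v; exists (cone_cell f v); first exact: cone_cell_in.
  by rewrite !inE eqxx orbT.
have := ps_size ps f; case E : (cyc f) => [|u c] // _.
exists (cone_cell f u); first by apply: cone_cell_in; rewrite E inE eqxx.
by rewrite !inE eqxx.
Qed.

Lemma face_link f : is_link cone_complex (inr f) (map inl (cyc f)).
Proof.
have inj_l : injective (@inl V F) by move=> ? ? [].
split.
- by rewrite map_inj_uniq // ps_uniq.
- by rewrite size_map ps_size.
- by apply/mapP => -[].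
- move=> _ /mapP[u uf ->]; exists (cone_cell f u); first exact: cone_cell_in.
  by rewrite next_map ?ps_uniq.
- move=> s /cone_complexP[f' [u [uf ->]]]; rewrite !inE !orbF => /eqP[->].
  exists (inl u); first exact: map_f.
  by rewrite next_map ?ps_uniq.
Qed.

(** The next face around [v], across the edge through which [cyc f] arrives
at [v].  It is the identity on the faces away from [v], hence a permutation of
all faces. *)
Definition rotate (v : V) (f : F) : F :=
  odflt f [pick f' | dart (cyc f') v (prev (cyc f) v)].

Lemma rotate_dart v f : v \in cyc f -> dart (cyc (rotate v f)) v (prev (cyc f) v).
Proof.
move=> vf; rewrite /rotate; case: pickP => //= h.
have [f' hf'] := ps_rev ps (dart_prev (ps_uniq ps f) vf).
by have := h f'; rewrite hf'.
Qed.

Lemma rotate_mem v f : v \in cyc f -> v \in cyc (rotate v f).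
Proof. by move=> /rotate_dart/dart_mem[]. Qed.

Lemma rotate_out v f : v \notin cyc f -> rotate v f = f.
Proof.
move=> vf; have pv : prev (cyc f) v = v.
  have := prev_nth (cyc f) v.
  by rewrite (negPf vf).
rewrite /rotate; case: pickP => //= f'; rewrite pv => d.
have [vf' _] := dart_mem d; have := pentagon_next2 (ps_uniq ps f') (ps_size ps f') vf'.
by case/andP: d => _ /eqP e; rewrite !e eqxx.
Qed.

Lemma dart_rotate v u f f' : dart (cyc f) u v -> dart (cyc f') v u -> rotate v f = f'.
Proof.
move=> d d'; have [_ vf] := dart_mem d.
apply: (ps_orient ps (rotate_dart vf)).
by rewrite (dart_inj (ps_uniq ps f) (dart_prev (ps_uniq ps f) vf) d).
Qed.

Lemma rotate_inj v : injective (rotate v).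
Proof.
move=> f f'; have [vf|vf] := boolP (v \in cyc f); have [vf'|vf'] := boolP (v \in cyc f').
- move=> e; have /andP[_ /eqP d] := rotate_dart vf.
  have /andP[_ /eqP d'] := rotate_dart vf'.
  apply: (ps_orient ps (dart_prev (ps_uniq ps f) vf)).
  rewrite -d e d'; exact: dart_prev (ps_uniq ps f') vf'.
- by rewrite (rotate_out vf') => e; rewrite -e rotate_mem in vf'.
- by rewrite (rotate_out vf) => e; rewrite e rotate_mem in vf.
- by rewrite !rotate_out.
Qed.

(** Being connected, the faces around [v] form a single cycle of the
rotation. *)
Lemma orbit_rotate v f0 f : v \in cyc f0 ->
  (f \in orbit (rotate v) f0) = (v \in cyc f).
Proof.
move=> vf0; apply/idP/idP.
  rewrite -fconnect_orbit => /iter_findex <-.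
  by elim: (findex _ _ _) => //= n IH; exact: rotate_mem.
move=> vf; apply: (ps_link ps (v := v) (P := fun f => f \in orbit (rotate v) f0) _ vf0 vf);
  last by rewrite -fconnect_orbit connect0.
move=> g g' u d d'; rewrite -!fconnect_orbit -(dart_rotate d d').
by rewrite same_fconnect1_r //; exact: rotate_inj.
Qed.

(** The rotation lists the faces around [v] cyclically; between a face and
the next one comes the edge that they share. *)
Lemma vertex_link v : exists l, is_link cone_complex (inl v) l.
Proof.
have [f0 vf0] := ps_cover v.
pose o := orbit (rotate v) f0.
have oE f : (f \in o) = (v \in cyc f) by exact: orbit_rotate.
have Uo : uniq o by exact: orbit_uniq.
pose a (f : F) : W := inr f; pose b (f : F) : W := inl (prev (cyc f) v).
have a_inj : injective a by move=> ? ? [].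
have Ui : uniq (interleave a b o).
  rewrite (perm_uniq (perm_interleave a b o)) cat_uniq !map_inj_in_uniq ?Uo //=.
  - by rewrite andbT; apply/hasPn => _ /mapP[f _ ->]; apply/mapP => -[].
  - move=> f f'; rewrite !oE => vf vf' [e].
    apply: (ps_orient ps (dart_prev (ps_uniq ps f) vf)).
    by rewrite e dart_prev ?ps_uniq.
  - by move=> f f' _ _; exact: a_inj.
have nexto f : f \in o -> next o f = rotate v f.
  move=> fo; have := next_cycle (cycle_orbit (@rotate_inj v) f0) fo.
  by move=> /eqP.
have nexti f : f \in o -> next (interleave a b o) (a f) = b f /\
    next (interleave a b o) (b f) = a (rotate v f).
  by move=> fo; rewrite -nexto //; exact: next_interleave.
exists (interleave a b o); split=> //.
- rewrite size_interleave; suff : (1 < size o)%N by move: (size o) => k; lia.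
  have rv : rotate v f0 \in o by rewrite oE rotate_mem.
  have f0o : f0 \in o by rewrite oE.
  have : rotate v f0 != f0.
    apply/eqP => e; have /andP[_] := rotate_dart vf0; rewrite e.
    have := pentagon_next2 (ps_uniq ps f0) (ps_size ps f0) vf0.
    move=> + /eqP e'; rewrite e' next_prev ?ps_uniq ?eqxx //.
  by move: rv f0o; case: (o) => [|x [|y s]] //=; rewrite !inE => /eqP-> /eqP->; rewrite eqxx.
- apply/negP => /mem_interleave[f fo [//|[e]]].
  move: fo; rewrite oE => vf; have := dart_prev (ps_uniq ps f) vf; rewrite -e =>
    /andP[_ /eqP h].
  by have := pentagon_next2 (ps_uniq ps f) (ps_size ps f) vf; rewrite !h eqxx.
- move=> _ /mem_interleave[f fo [->|->]]; have [e1 e2] := nexti f fo;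
    move: (fo); rewrite oE => vf.
    exists (cone_cell f (prev (cyc f) v)); first by rewrite cone_cell_in // mem_prev.
    rewrite e1 /cone_cell next_prev ?ps_uniq //; apply/fintype.subsetP => x.
    by rewrite !inE => /orP[/orP[]|] /eqP->; rewrite eqxx ?orbT.
  exists (cone_cell (rotate v f) v); first by rewrite cone_cell_in // rotate_mem.
  have /andP[_ /eqP d] := rotate_dart vf.
  rewrite e2 /cone_cell d; apply/fintype.subsetP => x.
  by rewrite !inE => /orP[/orP[]|] /eqP->; rewrite eqxx ?orbT.
- move=> s /cone_complexP[f [u [uf ->]]]; rewrite !inE /= => /orP[]/eqP[].
    move=> vu; subst u; have fo : f \in o by rewrite oE.
    pose g := prev o f; have go : g \in o by rewrite mem_prev.
    have gf : rotate v g = f by rewrite -nexto // next_prev.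
    have [_ e2] := nexti g go; move: (go); rewrite oE => vg.
    exists (b g); first by have [] := interleave_mem a b go.
    have /andP[_ /eqP d] := rotate_dart vg; rewrite gf in d.
    rewrite e2 gf /cone_cell d; apply/fintype.subsetP => x.
    by rewrite !inE => /orP[/orP[]|] /eqP->; rewrite eqxx ?orbT.
  move=> vu; have fo : f \in o by rewrite oE vu mem_next.
  have [e1 _] := nexti f fo.
  exists (a f); first by have [] := interleave_mem a b fo.
  have pv : prev (cyc f) v = u by rewrite vu prev_next // (ps_uniq ps).
  rewrite e1 /b pv /cone_cell -vu; apply/fintype.subsetP => x.
  by rewrite !inE => /orP[/orP[]|] /eqP->; rewrite eqxx ?orbT.
Qed.

Lemma cone_link w : exists l, is_link cone_complex w l.
Proof. by case: w => [v|f]; [exact: vertex_link|exists (map inl (cyc f));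
  exact: face_link]. Qed.

End PentagonalSurface.

(** * The map carried by the realization of a pentagonal surface *)

Section ConeMap.
Variables (R : realType) (V F : finType) (cyc : F -> seq V).
Hypothesis ps : pentagonal_surface cyc.
Local Notation W := (V + F)%type.
Local Notation K := (cone_complex cyc).
Local Notation S := (realization R K).
Let U f := ps_uniq ps f.
Let sz f := ps_size ps f.

Definition vertex (v : V) : S := vpoint R (cone_cover ps) (inl v).
Definition edge (u v : V) : set S := [set x | carried [set inl u; inl v]%SET (bary x)].
Definition adj : rel V := fun u v => [exists f, dart (cyc f) u v].
Definition cface (f : F) : set S := cstar (inr f).

Lemma adjP u v : reflect (exists f, dart (cyc f) u v) (adj u v).
Proof. exact: existsP. Qed.

Lemma adj_sym : symmetric adj.
Proof.
suff h u v : adj u v -> adj v u by move=> u v; apply/idP/idP; exact: h.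
by move=> /adjP[f /(ps_rev ps)/adjP].
Qed.

Lemma dart_neq f u v : dart (cyc f) u v -> u != v.
Proof.
move=> d; have [uf _] := dart_mem d; have := pentagon_next2 (U f) (sz f) uf.
case/andP: d => _ /eqP e; apply: contraNneq => uv; subst u.
by rewrite !e.
Qed.

Lemma adj_irr : irreflexive adj.
Proof. by move=> u; apply/adjP => -[f /dart_neq]; rewrite eqxx. Qed.

Lemma vertex_inj : injective vertex.
Proof. by move=> u v /vpoint_inj[]. Qed.

Lemma edgeC u v : edge u v = edge v u.
Proof. by rewrite /edge finset.setUC. Qed.

Lemma adj_cell u v : adj u v -> exists2 s, s \in K & (inl u \in s) && (inl v \in s).
Proof.
move=> /adjP[f d]; have [uf _] := dart_mem d; exists (cone_cell cyc f u).
  exact: cone_cell_in.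
by case/andP: d => _ /eqP e; rewrite !inE e !eqxx !orbT.
Qed.

Lemma adj_arc u v : adj u v -> is_arc R (vertex u) (vertex v) (edge u v).
Proof.
move=> uv; have [s sK /andP[us vs]] := adj_cell uv.
apply: (segment_arc R (cone_cover ps) sK us vs); apply: contraTneq uv => -[->].
by rewrite adj_irr.
Qed.

Lemma edge_vertex u v w : edge u v (vertex w) <-> w = u \/ w = v.
Proof.
rewrite /edge /= carried_vpoint !inE; split.
  by case/orP => /eqP[]; auto.
by case=> ->; rewrite eqxx ?orbT.
Qed.

(** A point of two edges with a coordinate at each of two vertices would make
both edges equal to the pair of these vertices. *)
Lemma edge_meet u v u' v' : adj u v -> adj u' v' ->
  [set u; v]%SET != [set u'; v']%SET ->
  edge u v `&` edge u' v' `<=` range vertex.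
Proof.
move=> a a' n x [h h'].
have [w hw]: exists w : W, bary x w != 0.
  apply/existsP; apply: contraT; rewrite negb_exists => /forallP h0.
  have := bary_sum x; rewrite big1 => [/esym/eqP|w _]; first by rewrite oner_eq0.
  by apply/eqP; have := h0 w; rewrite negbK.
have := carried_in h hw; have := carried_in h' hw.
case: w hw => [w hw|f]; last by rewrite !inE.
rewrite !inE !(inj_eq (@inl_inj V F)) => w' w1.
exists w => //; apply/esym/carried_set1 => y; rewrite inE => yw.
apply/eqP; apply: contraNT n => hy.
have := carried_in h hy; have := carried_in h' hy.
case: y yw hy => [y yw hy|f _ _]; last by rewrite !inE.
rewrite !inE !(inj_eq (@inl_inj V F)) in yw * => y' y1.
have two p q : (w == p) || (w == q) -> (y == p) || (y == q) -> [set p; q]%SET = [set w; y]%SET.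
  case/orP=> /eqP ?; case/orP=> /eqP ?; subst; rewrite ?eqxx // in yw *.
  by rewrite finset.setUC.
by rewrite (two _ _ w1 y1) (two _ _ w' y').
Qed.

Definition cone_map : graph_embedding R S :=
  @GraphEmbedding R S V adj vertex edge adj_sym adj_irr vertex_inj
    (fun u v _ => edgeC u v) adj_arc
    (fun u v w _ h => (edge_vertex u v w).1 h) edge_meet.

Local Notation M := cone_map.

Lemma cfaceP f x : cface f x <->
  exists2 u, u \in cyc f & carried (cone_cell cyc f u) (bary x).
Proof.
split=> [[s sK [fs hs]]|[u uf h]].
  case/cone_complexP: sK => f' [u [uf es]]; move: fs hs; rewrite es.
  by rewrite !inE !orbF => /eqP[->]; exists u.
by exists (cone_cell cyc f u); [exact: cone_cell_in|split=> //; rewrite !inE eqxx].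
Qed.

Lemma cface_exists x : exists f, cface f x.
Proof.
have [s sK hs] := bary_carried x; case/cone_complexP: (sK) => f [u [uf es]].
by exists f; apply/cfaceP; exists u => //; rewrite -es.
Qed.

Lemma cone_cell_edge f u x : (forall g, bary x (inr g) = 0) ->
  carried (cone_cell cyc f u) (bary x) -> edge u (next (cyc f) u) x.
Proof.
move=> x0 h [v|g] vn; last exact: x0.
by apply: h; move: vn; rewrite !inE.
Qed.

Lemma edge_no_face u v x g : edge u v x -> bary x (inr g) = 0.
Proof. by apply; rewrite !inE. Qed.

(** The graph is where the coordinates at all cone points vanish, so its
complement is the union of the open stars of the cone points. *)
Lemma drawingE x : drawing M x <-> forall f, bary x (inr f) = 0.
Proof.
split=> [[[v _ <-] f|[u [v [_ h]]] f]|h].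
- by rewrite /= bary_vpoint.
- exact: edge_no_face h.
- have [f /cfaceP[u uf hu]] := cface_exists x.
  right; exists u, (next (cyc f) u); split; last exact: cone_cell_edge hu.
  by apply/adjP; exists f; exact: dart_next.
Qed.

Lemma star_face_disjoint f f' (x : S) : 0 < bary x (inr f) -> 0 < bary x (inr f') -> f = f'.
Proof.
move=> h h'; have [g /cfaceP[u _ hu]] := cface_exists x.
have : inr f \in cone_cell cyc g u by apply: (carried_in hu); rewrite gt_eqF.
have : inr f' \in cone_cell cyc g u by apply: (carried_in hu); rewrite gt_eqF.
by rewrite !inE !orbF => /eqP[->] /eqP[->].
Qed.

Lemma not_drawing x : (~` drawing M) x <-> exists f, 0 < bary x (inr f).
Proof.
split=> [h|[f h]]; last by move=> /drawingE/(_ f) e; rewrite e ltxx in h.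
apply: contrapT => n; apply: h; apply/drawingE => f.
apply/eqP; apply: contraT => h; case: n; exists f.
by rewrite lt_neqAle eq_sym h bary_ge0.
Qed.

(** The open stars of the cone points are connected, open and
disjoint, and the closure of one of them does not reach the others. *)
Lemma component_star f x : 0 < bary x (inr f) ->
  connected_component (~` drawing M) x = star (inr f).
Proof.
move=> xf; have lk := face_link ps f.
have sub : star (inr f) `<=` ~` drawing M by move=> y yf; apply/not_drawing; exists f.
apply/seteqP; split; last first.
  by apply: connected_component_max => //; exact: (star_connected lk).
pose B : set S := \bigcup_(g in [set g | g != f]) star (inr g).
have sep : separated (star (inr f)) B.
  split.
    rewrite (closure_star R lk) -subset0 => y [/cfaceP[u _ hu] [g /= gf yg]].
    have : inr g \in cone_cell cyc f u by apply: (carried_in hu); rewrite gt_eqF.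
    by rewrite !inE !orbF => /eqP[e]; rewrite e eqxx in gf.
  rewrite -subset0 => y [yf cy].
  have [z [[g /= gf zg] zf]] := cy _ (open_nbhs_nbhs (conj (@star_open R W K (inr f)) yf)).
  by rewrite (star_face_disjoint zg zf) eqxx in gf.
have cov : connected_component (~` drawing M) x `<=` star (inr f) `|` B.
  move=> y /connected_component_sub/not_drawing[g yg].
  by have [e|gf] := eqVneq g f; [left; rewrite -e|right; exists g].
have [//|h] := connected_subset sep cov (@component_connected _ _ _).
have xC : connected_component (~` drawing M) x x.
  by apply: connected_component_refl; exact: sub.
have [g /= gf xg] := h _ xC.
by rewrite (star_face_disjoint xg xf) eqxx in gf.
Qed.

Lemma apex_bary f : bary (vpoint R (cone_cover ps) (inr f)) (inr f) = 1.
Proof. by rewrite bary_vpoint eqxx. Qed.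

Lemma facesE : faces M = range cface.
Proof.
apply/seteqP; split=> [_ [x /not_drawing[f xf] <-]|_ [f _ <-]].
  exists f => //; rewrite (component_star xf).
  by rewrite (closure_star R (face_link ps f)).
pose x := vpoint R (cone_cover ps) (inr f).
have xf : 0 < bary x (inr f) by rewrite apex_bary.
exists x; first by apply/not_drawing; exists f.
by rewrite (component_star xf) (closure_star R (face_link ps f)).
Qed.

Lemma cface_face f : faces M (cface f).
Proof. by rewrite facesE; exists f. Qed.

Lemma cface_inj : injective cface.
Proof.
move=> f g e; pose x := vpoint R (cone_cover ps) (inr f).
have : cface f x by apply: star_cstar; rewrite /star /= apex_bary.
rewrite e => /cfaceP[u _ hu].
have : inr f \in cone_cell cyc g u by apply: (carried_in hu); rewrite apex_bary oner_eq0.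
by rewrite !inE !orbF => /eqP[].
Qed.

Lemma cone_map_is_map : is_map M.
Proof.
split=> [v|F0]; first exact: ps_degree.
rewrite facesE => -[f _ <-]; exact: (cstar_2cell R (face_link ps f)).
Qed.

Lemma cface_carried f x : cface f x -> forall w : W, bary x w != 0 ->
  w = inr f \/ exists2 v, v \in cyc f & w = inl v.
Proof.
move=> /cfaceP[u uf h] w /(carried_in h); rewrite !inE => /orP[/orP[]|] /eqP->.
- by left.
- by right; exists u.
- by right; exists (next (cyc f) u); rewrite ?mem_next.
Qed.

Lemma cface_vertex f v : v \in cyc f -> cface f (vertex v).
Proof.
move=> vf; apply/cfaceP; exists v => //.
by apply/carried_vpoint; rewrite !inE eqxx orbT.
Qed.

Lemma edge_cface f u v : dart (cyc f) u v || dart (cyc f) v u -> edge u v `<=` cface f.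
Proof.
wlog d : u v / dart (cyc f) u v.
  by move=> h /orP[] d; [|rewrite edgeC]; apply: h; rewrite ?d.
move=> _ x hx; apply/cfaceP; exists u; first by case/andP: d.
apply: carried_subset hx; case/andP: d => _ /eqP<-.
by apply/fintype.subsetP => w; rewrite !inE => /orP[]->; rewrite !orbT.
Qed.

(** A point of two faces has no coordinate at a cone point, so its support
consists of common vertices. *)
Lemma cface_meet f f' x : f != f' -> cface f x -> cface f' x ->
  forall w : W, bary x w != 0 ->
  exists v, [/\ w = inl v, v \in cyc f & v \in cyc f'].
Proof.
move=> n h h' w hw; have [e|[v vf e]] := cface_carried h hw;
  have [e'|[v' vf' e']] := cface_carried h' hw; rewrite e in e' *.
- by case: e' n => ->; rewrite eqxx.
- by [].
- by [].
- by exists v; split=> //; case: e' => ->.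
Qed.

(** If two faces share two vertices, these are adjacent; a third
common vertex would complete a triangle in a pentagon. *)
Lemma cone_map_polyhedral : polyhedral M.
Proof.
split; first exact: cone_map_is_map.
move=> F1 F2; rewrite !facesE => -[f _ <-] [f' _ <-] nF.
have n : f != f' by apply/eqP => e; apply: nF; rewrite e.
have n' : f' != f by rewrite eq_sym.
(* No common vertex, exactly one, or at least two. *)
have [[u [uf uf']]|no] := pselect (exists u, u \in cyc f /\ u \in cyc f'); last first.
  constructor 1; rewrite -subset0 => x [h h'].
  have [w hw] : exists w : W, bary x w != 0.
    apply: contrapT => n0; have := bary_sum x; rewrite big1 => [/esym/eqP|w _].
      by rewrite oner_eq0.
    by apply/eqP; apply: contraT => h0; case: n0; exists w.
  by have [v [_ vf vf']] := cface_meet n h h' hw; case: no; exists v.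
have [[v [uv vf vf']]|no] := pselect (exists v, [/\ u != v, v \in cyc f & v \in cyc f']);
  last first.
  constructor 2; exists u; apply/seteqP; split=> [x [h h']|_ ->]; last first.
    by split; exact: cface_vertex.
  apply: carried_set1 => w; rewrite inE => wu; apply/eqP; apply: contraT => hw.
  have [v [e vf vf']] := cface_meet n h h' hw; case: no; exists v; split=> //.
  by apply: contraNneq wu => ->; rewrite e.
have d := ps_meet ps n uv uf vf uf' vf'.
have d' := ps_meet ps n' uv uf' vf' uf vf.
constructor 3; exists u, v; split.
  by case/orP: d => d; [|rewrite /= adj_sym]; apply/adjP; exists f.
apply/seteqP; split=> [x [h h'] w|x hx]; last by split; apply: edge_cface hx.
rewrite !inE negb_or => /andP[wu wv]; apply/eqP; apply: contraT => hw.
have [y [e yf yf']] := cface_meet n h h' hw; rewrite e !(inj_eq (@inl_inj V F)) in wu wv.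
rewrite eq_sym in wu; rewrite eq_sym in wv.
have := pentagon_no_triangle (U f) (sz f) uv d wu (ps_meet ps n wu uf yf uf' yf').
by move=> /(_ wv (ps_meet ps n wv vf yf vf' yf')).
Qed.

Definition cycle_edges (c : seq V) : set S :=
  [set x | exists2 v, v \in c & edge v (next c v) x].

Lemma cface_boundary f : cface f `&` drawing M = cycle_edges (cyc f).
Proof.
apply/seteqP; split=> [x [/cfaceP[u uf h] /drawingE x0]|x [u uf h]].
  by exists u => //; exact: cone_cell_edge.
split; last by apply/drawingE => g; exact: edge_no_face h.
by apply: edge_cface h; rewrite dart_next.
Qed.

Lemma adj_cyc f : ucycle adj (cyc f).
Proof.
rewrite /ucycle U andbT; apply: cycle_from_next => // u uf.
by apply/adjP; exists f; exact: dart_next.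
Qed.

Lemma cone_map_bounded f : @bounded_by R S M (cface f) (cyc f).
Proof. by split; [exact: adj_cyc|rewrite sz|exact: cface_boundary]. Qed.

Lemma cone_map_pentagons : all_faces_pentagons M.
Proof.
move=> F0; rewrite facesE => -[f _ <-].
by exists (cyc f); [exact: cone_map_bounded|exact: sz].
Qed.

(** A face, as a set of points, determines its index, and the
cycles were coherently oriented from the start. *)
Lemma cone_map_orientable : orientable_map M.
Proof.
pose o (F0 : set S) : seq V := if pselect (exists f, F0 = cface f) is left h
  then cyc (projT1 (cid h)) else [::].
have oE f : o (cface f) = cyc f.
  rewrite /o; case: pselect => [h|[]]; last by exists f.
  by case: cid => g /= /cface_inj ->.
exists o; split=> [F0|F0 F1 u]; rewrite !facesE.
  by move=> [f _ <-]; rewrite oE; exact: cone_map_bounded.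
move=> [f _ <-] [f' _ <-]; rewrite !oE => uf uf' e; congr cface.
by apply: (ps_orient ps (dart_next uf)); rewrite e dart_next.
Qed.

(** The set of points of a cycle determines its edges: the midpoint of an
edge has its two end points as support, and so lies on no other edge. *)
Lemma cycle_edges_dart c c' u v : cycle_edges c `<=` cycle_edges c' -> adj u v ->
  dart c u v -> dart c' u v || dart c' v u.
Proof.
move=> sub uv d; have [s sK /andP[us vs]] := adj_cell uv.
have nuv : u != v by apply: contraTneq uv => ->; rewrite adj_irr.
have h01 : 0 <= (2^-1 : R) <= 1 by rewrite invr_ge0 ler0n invf_le1 ?ler1n.
pose m : S := point (segment_polyhedron sK us vs h01).
have mE w : bary m w = segment_bary (inl u) (inl v) 2^-1 w by rewrite point_bary.
have half : 1 - 2^-1 = 2^-1 :> R by field.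
have mu : bary m (inl u) != 0.
  rewrite mE /segment_bary eqxx (inj_eq (@inl_inj V F)) (negPf nuv) mulr0 addr0 mulr1 half.
  by rewrite invr_eq0 pnatr_eq0.
have mv : bary m (inl v) != 0.
  rewrite mE /segment_bary eqxx (inj_eq (@inl_inj V F)) (eq_sym v) (negPf nuv) mulr0 add0r mulr1.
  by rewrite invr_eq0 pnatr_eq0.
have [w wc' hw] : cycle_edges c' m.
  apply: sub; exists u; first by case/andP: d.
  case/andP: d => _ /eqP->; move=> w; rewrite !inE negb_or => /andP[/negPf h1 /negPf h2].
  by rewrite mE /segment_bary h1 h2 !mulr0 addr0.
have := carried_in hw mu; have := carried_in hw mv.
rewrite !inE !(inj_eq (@inl_inj V F)) /dart.
case/orP=> /eqP ev; case/orP=> /eqP eu; rewrite ?ev ?eu ?wc' ?eqxx ?orbT //;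
  by rewrite ev eu eqxx in nuv.
Qed.

Lemma dart_cycle_edges c c' :
  (forall u v, dart c u v -> dart c' u v || dart c' v u) ->
  cycle_edges c `<=` cycle_edges c'.
Proof.
move=> h x [u uc hx]; case/orP: (h _ _ (dart_next uc)) => /andP[vc' /eqP e].
  by exists u; rewrite ?e.
by exists (next c u) => //; rewrite e edgeC.
Qed.

Lemma cycle_dart_adj c u v : ucycle adj c -> dart c u v -> adj u v.
Proof. by move=> /andP[cc _] /andP[uc /eqP <-]; exact: next_cycle. Qed.

(** A facial cycle may be given by any starting point and direction; it has
the same edges as the chosen cycle of its face. *)
Lemma facial_dart f c u v : @bounded_by R S M (cface f) c ->
  dart c u v || dart c v u = dart (cyc f) u v || dart (cyc f) v u.
Proof.
move=> [cc _ eB]; have e : cycle_edges (cyc f) = cycle_edges c.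
  by rewrite -cface_boundary eB.
have h1 x y : dart c x y -> dart (cyc f) x y || dart (cyc f) y x.
  by move=> d; apply: (cycle_edges_dart _ (cycle_dart_adj cc d) d); rewrite e.
have h2 x y : dart (cyc f) x y -> dart c x y || dart c y x.
  by move=> d; apply: (cycle_edges_dart _ (cycle_dart_adj (adj_cyc f) d) d); rewrite e.
by apply/idP/idP => /orP[] d; first [exact: h1|exact: h2|rewrite orbC;
  first [exact: h1|exact: h2]].
Qed.

Section Symmetry.
Variable s : V -> V.
Hypothesis s_inv : involutive s.
Hypothesis s_face : forall f, exists f', forall u v,
  dart (cyc f') (s v) (s u) = dart (cyc f) u v.
Hypothesis s_free : forall f v, v \in cyc f -> s v \notin cyc f.

Let s_inj : injective s := inv_inj s_inv.

Lemma adj_s u v : adj (s u) (s v) = adj u v.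
Proof.
suff h x y : adj x y -> adj (s x) (s y).
  by apply/idP/idP => [/h|/h]; rewrite // !s_inv.
move=> /adjP[f d]; have [f' h] := s_face f; rewrite adj_sym; apply/adjP; exists f'.
by rewrite h.
Qed.

Lemma dart_map c u v : uniq c -> dart (map s c) (s u) (s v) = dart c u v.
Proof. by move=> Uc; rewrite /dart mem_map // next_map // (inj_eq s_inj). Qed.

(** The hypothesis on [s] reverses the darts, as an antipode
does with the orientation; facial cycles are undirected and do not feel it. *)
Lemma cone_map_symmetric : centrally_symmetric M.
Proof.
split; first exact: cone_map_polyhedral.
exists s; split; split=> //.
- exact: adj_s.
- move=> c [F0]; rewrite facesE => -[f _ <-] b; have [cc c2 _] := b.
  have Uc : uniq c by case/andP: cc.
  have [f' hf'] := s_face f; exists (cface f'); first exact: cface_face.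
  split; last 1 first.
  + rewrite cface_boundary; apply/seteqP; split; apply: dart_cycle_edges => u v d.
      rewrite -[u]s_inv -[v]s_inv !dart_map // (facial_dart _ _ b) -!hf' !s_inv d.
      by rewrite orbT.
    rewrite -[u]s_inv -[v]s_inv !dart_map // in d *.
    rewrite !hf' orbC -(facial_dart _ _ b).
    by rewrite d.
  + rewrite /ucycle map_inj_uniq // Uc andbT.
    by rewrite (mono_cycle adj_s); case/andP: cc.
  + by rewrite size_map.
- move=> v; have [f vf] := ps_cover ps v; apply: contraTneq vf => e.
  by apply/negP => vf; have := s_free vf; rewrite e vf.
- move=> u v /adjP[f d]; have [uf vf] := dart_mem d.
  apply: contraTneq (s_free uf) => e; rewrite negbK.
  have : s u \in [set s u; s v]%SET by rewrite !inE eqxx.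
  by rewrite e !inE => /orP[]/eqP->.
- move=> c [F0]; rewrite facesE => -[f _ <-] b e.
  have mc v : v \in c -> v \in cyc f.
    move=> vc; have := facial_dart v (next c v) b; rewrite dart_next //=.
    by move=> /esym/orP[] /dart_mem[].
  have [_ c2 _] := b; case: c c2 e b mc => // v c _ e b mc.
  have vc : v \in v :: c by rewrite inE eqxx.
  have := s_free (mc _ vc); rewrite mc // -e; exact: map_f.
Qed.

End Symmetry.

(** Closed faces are connected, and adjacent vertices lie on a common
face; so connectedness of the graph suffices. *)
Lemma cone_map_surface : F -> is_surface R S.
Proof.
move=> f0; have [v0 v0f] : exists v0, v0 \in cyc f0.
  by have := sz f0; case: (cyc f0) => // v l _; exists v; rewrite inE eqxx.
have connf f x y : cface f x -> cface f y -> connected_component [set: S] x y.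
  move=> xf yf; apply: (connected_component_max xf _ _ yf) => //.
  rewrite /cface -(closure_star R (face_link ps f)); apply: connected_closure.
  exact: star_connected (face_link ps f).
split.
- by exists (vertex v0).
- exact: realization_hausdorff.
- exact: realization_compact.
- pose P v := connected_component [set: S] (vertex v0) (vertex v).
  have Pall v : P v.
    apply: (ps_connected ps (P := P) _ (u := v0)); last exact: connected_component_refl.
    move=> f u w d; have [uf wf] := dart_mem d => h; apply: connected_component_trans h _.
    by apply: (connf f); exact: cface_vertex.
  rewrite (_ : [set: S] = connected_component [set: S] (vertex v0)).
    exact: component_connected.
  apply/seteqP; split=> // x _; have [f xf] := cface_exists x.
  have [v vf] : exists v, v \in cyc f.
    by have := sz f; case: (cyc f) => // v l _; exists v; rewrite inE eqxx.
  by apply: connected_component_trans (Pall v) _; apply: (connf f) => //; exact: cface_vertex.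
- move=> x; have [w hw] : exists w : W, bary x w != 0.
    apply: contrapT => n0; have := bary_sum x; rewrite big1 => [/esym/eqP|w _].
      by rewrite oner_eq0.
    by apply/eqP; apply: contraT => h0; case: n0; exists w.
  have [l lk] := cone_link ps w; have [B [oB hB]] := star_plane R lk.
  exists (star w), B; split=> //; first exact: star_open.
  by rewrite /star /= lt_neqAle eq_sym hw bary_ge0.
Qed.

(** Darts are counted twice: every face has five, every edge has two. *)
Lemma card_graph_edges : (2 * #|graph_edges M| = 5 * #|F|)%N.
Proof.
pose D := [set p : V * V | adj p.1 p.2]%SET.
have -> : graph_edges M = [set [set p.1; p.2]%SET | p in D]%SET.
  by apply/setP => A; apply/imsetP/imsetP => -[p]; rewrite inE => pD ->; exists p; rewrite ?inE.
have cD : (#|D| = 5 * #|F|)%N.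
  pose E := [set p : F * V | p.2 \in cyc p.1]%SET.
  have -> : D = [set (p.2, next (cyc p.1) p.2) | p in E]%SET.
    apply/setP => -[u v]; rewrite inE; apply/adjP/imsetP => /= [[f d]|[[f w]]].
      have [uf _] := dart_mem d; exists (f, u); rewrite ?inE //=.
      by case/andP: d => _ /eqP->.
    by rewrite inE /= => wf [-> ->]; exists f; exact: dart_next.
  rewrite card_in_imset; last first.
    move=> [f u] [f' u']; rewrite !inE /= => uf uf' [e e']; subst u'.
    by congr pair; apply: (ps_orient ps (dart_next uf)); rewrite e'; exact: dart_next.
  rewrite cardsE -sum1_card (eq_bigl (fun p : F * V => true && (p.2 \in cyc p.1))) //.
  rewrite -(pair_big_dep xpredT (fun f u => u \in cyc f) (fun _ _ => 1%N)) /=.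
  rewrite (eq_bigr (fun _ => 5)); first by rewrite sum_nat_const mulnC.
  by move=> f _; rewrite sum1_card (card_uniqP (U f)) sz.
rewrite -cD -[#|D|]sum1_card (partition_big_imset (fun p : V * V => [set p.1; p.2]%SET)) /=.
rewrite (eq_bigr (fun _ => 2)); first by rewrite sum_nat_const mulnC.
move=> A /imsetP[[u v]]; rewrite inE /= => uv ->.
rewrite sum1_card (_ : 2 = #|[set (u, v); (v, u)]%SET|); last first.
  by rewrite cards2; case: eqP uv => // -[e _]; rewrite e adj_irr.
apply: eq_card => -[a b]; rewrite !inE /=.
apply/andP/orP => [[ab /eqP e]|[]/eqP[-> ->]]; rewrite ?inE /=.
- have : a \in [set u; v]%SET by rewrite -e !inE eqxx.
  have : b \in [set u; v]%SET by rewrite -e !inE eqxx orbT.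
  rewrite !inE => /orP[]/eqP eb /orP[]/eqP ea; rewrite ea eb in ab *;
    first [by rewrite inE /= adj_irr in ab|by left; rewrite eqxx|by right; rewrite eqxx].
- by split.
- by rewrite adj_sym uv finset.setUC eqxx.
Qed.

Lemma cone_map_euler (e : nat) : (2 * e = 5 * #|F|)%N ->
  euler_characteristic M (#|V|%:Z - e%:Z + #|F|%:Z).
Proof.
move=> ce; exists #|F|; last first.
  by rewrite (_ : #|graph_edges M| = e) //; have := card_graph_edges; lia.
rewrite facesE; apply: (@card_eq_trans _ _ _ _ [set: F]).
  by apply: inj_card_eq => f g _ _; exact: cface_inj.
rewrite card_eq_sym; apply: (card_eq_trans card_II).
have <- : range (@enum_rank F) = [set: 'I_#|F|].
  by apply/seteqP; split=> // i _; exists (enum_val i) => //; exact: enum_valK.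
by apply: inj_card_eq => f g _ _; exact: enum_rank_inj.
Qed.

End ConeMap.

(** * Attaching tubes: the combinatorial surfaces *)

(** Vertices come in antipodal pairs, numbered by the second component; the
boolean tells the two members of a pair apart. *)
Definition vlabel := (bool * nat)%type.
Definition anti (x : vlabel) : vlabel := (~~ x.1, x.2).
(** The antipode reverses the orientation, so the image of a face has to be
read backwards to be coherently oriented. *)
Definition opposite (f : seq vlabel) := rev (map anti f).
(** Only one face of each antipodal pair is listed in [L]. *)
Definition full (L : seq (seq vlabel)) := L ++ map opposite L.

(** The ten vertices of two opposite faces of a dodecahedron are the [rim]
vertices and their antipodes, the other ten the [mid] vertices and their
antipodes; indices are taken modulo 5. *)
Definition rim (i : nat) : vlabel := (false, i %% 5)%N.
Definition mid (i : nat) : vlabel := (false, 5 + i %% 5)%N.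
Definition cap := [seq rim i | i <- iota 0 5].
(** The five faces adjacent to [cap].  On a dodecahedron the common
neighbour of [mid i] and [mid i.+1] is the antipode of [mid (i + 3)]. *)
Definition belt := [seq [:: rim i; rim i.+1; mid i.+1; anti (mid (i + 3));
  mid i] | i <- iota 0 5].
Definition tube := full belt.
Definition caps := [:: cap; opposite cap].

Lemma antiK : involutive anti.
Proof. by case=> b i; rewrite /anti /= negbK. Qed.

Lemma oppositeK : involutive opposite.
Proof. by move=> f; rewrite /opposite map_rev revK -map_comp map_id_in // => x _;
  exact: antiK. Qed.

Lemma mem_opposite f x : (x \in opposite f) = (anti x \in f).
Proof. by rewrite mem_rev -{1}[x]antiK mem_map //; exact: inv_inj antiK. Qed.

Lemma full_opposite L f : f \in full L -> opposite f \in full L.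
Proof.
rewrite !mem_cat => /orP[fL|/mapP[f' fL ->]]; first by rewrite map_f ?orbT.
by rewrite oppositeK fL.
Qed.

(** The properties of the full list of faces that survive the attachment
of a tube.  The vertices in use are those numbered below [n]. *)
Record antipodal_surface (n : nat) (L : seq (seq vlabel)) : Prop := AntipodalSurface {
  inv_nodup : uniq (full L);
  inv_pent : forall f : seq vlabel, f \in full L ->
    [/\ uniq f, size f = 5 & forall x, x \in f -> (x.2 < n)%N];
  inv_orient : forall (f f' : seq vlabel) (u v : vlabel), f \in full L -> f' \in full L ->
    dart f u v -> dart f' u v -> f = f';
  inv_rev : forall (f : seq vlabel) (u v : vlabel), f \in full L -> dart f u v ->
    exists2 f' : seq vlabel, f' \in full L & dart f' v u;
  inv_link : forall v (P : seq vlabel -> Prop),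
    (forall (f f' : seq vlabel) (u : vlabel), f \in full L -> f' \in full L ->
       dart f u v -> dart f' v u -> P f <-> P f') ->
    forall f f' : seq vlabel, f \in full L -> f' \in full L -> v \in f -> v \in f' -> P f ->
      P f';
  inv_conn : forall P : vlabel -> Prop,
    (forall (f : seq vlabel) (u v : vlabel), f \in full L -> dart f u v -> P u -> P v) ->
    forall u v : vlabel, (u.2 < n)%N -> (v.2 < n)%N -> P u -> P v;
  inv_meet : forall (f f' : seq vlabel) (u v : vlabel), f \in full L -> f' \in full L ->
    f != f' -> u != v ->
    u \in f -> v \in f -> u \in f' -> v \in f' -> dart f u v || dart f v u;
  inv_deg : forall v : vlabel, (v.2 < n)%N -> exists s : seq vlabel,
    [/\ uniq s, (2 < size s)%N & forall w, w \in s -> exists2 f, f \in full L & dart f v w];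
  inv_anti : forall (f : seq vlabel) (v : vlabel), f \in full L -> v \in f -> anti v \notin f }.

(** Decidable forms, for explicit lists of faces, of the clauses of
[antipodal_surface]. *)
Definition check_pent n (fs : seq (seq vlabel)) :=
  all (fun f : seq vlabel => [&& uniq f, size f == 5 & all (fun x : vlabel => x.2 < n)%N f]) fs.
Definition check_orient (fs : seq (seq vlabel)) :=
  all (fun f : seq vlabel => all (fun f' : seq vlabel => all (fun u : vlabel =>
    dart f' u (next f u) ==> (f == f')) f) fs) fs.
(** Edges are matched up to free ends, which run along the cycles [cs]. *)
Definition check_rev (cs fs : seq (seq vlabel)) :=
  all (fun f : seq vlabel => all (fun u : vlabel => has (fun f' : seq vlabel =>
    dart f' (next f u) u) fs
                            || has (fun c : seq vlabel => dart c u (next f u)) cs) f) fs.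
(** Any two faces at a common vertex share an edge there: a sufficient
condition for their being connected around it, true where three faces meet and
at the ends of a tube. *)
Definition check_link (fs : seq (seq vlabel)) :=
  all (fun f : seq vlabel => all (fun f' : seq vlabel => all (fun v : vlabel =>
    [==> v \in f', f != f' => dart f' v (prev f v) || dart f' (next f v) v]) f) fs) fs.
Definition check_meet (fs : seq (seq vlabel)) :=
  all (fun f : seq vlabel => all (fun f' : seq vlabel => all (fun u : vlabel =>
    all (fun v : vlabel =>
    [==> f != f', u != v, u \in f', v \in f' => dart f u v || dart f v u]) f) f) fs) fs.
Definition check_deg (fs : seq (seq vlabel)) (v : vlabel) :=
  (2 < size (undup [seq next f v | f <- fs & v \in f]))%N.
Definition check_anti (fs : seq (seq vlabel)) :=
  all (fun f : seq vlabel => all (fun v : vlabel => anti v \notin f) f) fs.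

Section Checks.
Variables (fs : seq (seq vlabel)).

Lemma check_pentP n : check_pent n fs -> forall f : seq vlabel, f \in fs ->
  [/\ uniq f, size f = 5 & forall x, x \in f -> (x.2 < n)%N].
Proof. by move=> /allP h f /h /and3P[-> /eqP -> /allP]. Qed.

Lemma check_orientP : check_orient fs -> forall (f f' : seq vlabel) (u v : vlabel), f \in fs -> f' \in fs ->
  dart f u v -> dart f' u v -> f = f'.
Proof.
move=> /allP h f f' u v /h /allP h1 /h1 /allP h2 /andP[/h2 h3 /eqP<-].
by move: h3 => /implyP h3 /h3 /eqP.
Qed.

Lemma check_revP cs : check_rev cs fs -> forall (f : seq vlabel) (u v : vlabel), f \in fs ->
  dart f u v ->
  (exists2 f' : seq vlabel, f' \in fs & dart f' v u) \/ (exists2 c, c \in cs & dart c u v).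
Proof.
move=> /allP h f u v /h /allP h1 /andP[/h1 + /eqP <-].
by case/orP=> /hasP[x xs d]; [left|right]; exists x.
Qed.

Lemma check_linkP : check_link fs -> forall (f f' : seq vlabel) (v : vlabel), f \in fs ->
  f' \in fs ->
  v \in f -> v \in f' -> uniq f -> f = f' \/
  exists u, (dart f u v && dart f' v u) || (dart f v u && dart f' u v).
Proof.
move=> /allP h f f' v /h /allP h1 /h1 /allP h2 vf; have := h2 v vf.
move=> + vf' Uf; rewrite vf' /=; have [->|_ /=] := eqVneq f f'; first by left.
case/orP => d; right; [exists (prev f v)|exists (next f v)].
  by rewrite d dart_prev.
by rewrite d dart_next ?orbT.
Qed.

Lemma check_meetP : check_meet fs -> forall (f f' : seq vlabel) (u v : vlabel), f \in fs ->
  f' \in fs -> f != f' ->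
  u != v -> u \in f -> v \in f -> u \in f' -> v \in f' -> dart f u v || dart f v u.
Proof.
move=> /allP h f f' u v /h /allP h1 /h1 /allP h2 n m /h2 /allP h3 vf uf' vf'.
by have := h3 v vf; rewrite n m uf' vf'.
Qed.

Lemma check_degP v : check_deg fs v -> exists s : seq vlabel,
  [/\ uniq s, (2 < size s)%N & forall w, w \in s -> exists2 f, f \in fs & dart f v w].
Proof.
move=> h; exists (undup [seq next f v | f <- fs & v \in f]); split=> //.
  exact: undup_uniq.
move=> w; rewrite mem_undup => /mapP[f]; rewrite mem_filter => /andP[vf ff] ->.
by exists f => //; exact: dart_next.
Qed.

Lemma check_antiP : check_anti fs -> forall (f : seq vlabel) (v : vlabel), f \in fs ->
  v \in f -> anti v \notin f.
Proof. by move=> /allP h f v /h /allP h1 /h1. Qed.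

Fixpoint reach k (u : vlabel) : seq vlabel :=
  if k is k'.+1 then
    let r := reach k' u in
    undup (r ++ flatten [seq [seq next f x | f <- fs & x \in f] | x <- r])
  else [:: u].

Lemma reachP k u (P : vlabel -> Prop) :
  (forall (f : seq vlabel) (u v : vlabel), f \in fs -> dart f u v -> P u -> P v) -> P u ->
  forall v, v \in reach k u -> P v.
Proof.
move=> cP Pu; elim: k => /= [v|k IH v]; first by rewrite inE => /eqP->.
rewrite mem_undup mem_cat => /orP[|/flattenP[_ /mapP[x xr ->]]]; first exact: IH.
move=> /mapP[f]; rewrite mem_filter => /andP[xf ff] ->.
by apply: (cP f x) => //; [exact: dart_next|exact: IH].
Qed.

End Checks.

Definition labels_below n : seq vlabel := [seq (b, i) | b <- [:: false; true], i <- iota 0 n].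

Lemma mem_labels_below n (x : vlabel) : (x \in labels_below n) = (x.2 < n)%N.
Proof.
case: x => b i; apply/allpairsP/idP => [[[b' i'] /= [_ + [_ ->]]]|/= i_n].
  by rewrite mem_iota add0n.
by exists (b, i); rewrite /= mem_iota add0n i_n; case: b.
Qed.

(** The belt is closed by the cap.  The cap is reversed: made to replace
[cap], the belt runs along its edges in the same direction. *)
Definition dodecahedron := rcons belt (rev cap).

Lemma dodecahedron_antipodal : antipodal_surface 10 dodecahedron.
Proof.
have cp : check_pent 10 (full dodecahedron) by vm_compute.
split.
- by vm_compute.
- exact: check_pentP.
- by apply: check_orientP; vm_compute.
- move=> f u v ff d; have h : check_rev [::] (full dodecahedron) by vm_compute.
  by case: (check_revP h ff d) => [//|[]].
- move=> v P cP f f' ff ff' vf vf'.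
  have h : check_link (full dodecahedron) by vm_compute.
  have [Uf _ _] := check_pentP cp ff.
  have [->//|[u /orP[]/andP[d d']]] := check_linkP h ff ff' vf vf' Uf.
    by move=> /(cP _ _ _ ff ff' d d').
  by move=> /(cP _ _ _ ff' ff d' d).
- move=> P cP u v un vn Pu.
  (* The diameter of the dodecahedron is 5. *)
  have /allP h : all (fun u => all (fun v =>
    v \in reach (full dodecahedron) 5 u) (labels_below 10))
    (labels_below 10) by vm_compute.
  move: un vn; rewrite -!mem_labels_below => /h /allP h1 /h1; exact: reachP.
- by apply: check_meetP; vm_compute.
- move=> v; rewrite -mem_labels_below => vn; apply: check_degP.
  by move: v vn; apply/allP; vm_compute.
- by apply: check_antiP; vm_compute.
Qed.

Definition signed (b : bool) (x : vlabel) : vlabel := (b (+) x.1, x.2).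

(** Inserts the dodecahedron from which the tube is cut: the [rim] goes to the
removed face [f], its antipode to the antipodal face, and the [mid] vertices
get new numbers. *)
Definition glue (n : nat) (f : seq vlabel) (x : vlabel) : vlabel :=
  if (x.2 < 5)%N then signed x.1 (nth (rim 0) f x.2) else (x.1, n + (x.2 - 5))%N.

(** The belt and its opposite are the ten faces of the tube.  The first
of the new faces comes to the head and is the next one to be removed. *)
Definition attach_tube n (L : seq (seq vlabel)) :=
  if L is f :: L' then map (map (glue n f)) belt ++ L' else L.

Section Attach.
Variables (n : nat) (F : seq vlabel) (rest : seq (seq vlabel)).
Hypothesis iv : antipodal_surface n (F :: rest).
Let L := F :: rest.
Let L' := attach_tube n L.
Let io := glue n F.

Let F_full : F \in full L. Proof. by rewrite mem_cat inE eqxx. Qed.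
Let uF : uniq F. Proof. by case: (inv_pent iv F_full). Qed.
Let sF : size F = 5. Proof. by case: (inv_pent iv F_full). Qed.
Let nF i : (i < 5)%N -> ((nth (rim 0) F i).2 < n)%N.
Proof.
by move=> i5; have [_ _] := inv_pent iv F_full; apply; rewrite mem_nth ?sF.
Qed.

Let io_old x : ((io x).2 < n)%N = (x.2 < 5)%N.
Proof.
rewrite /io /glue; case: ifP => /= [/nF->//|_]; lia.
Qed.

(** Distinct rim vertices stay distinct because the removed face does not
meet its antipode. *)
Let io_inj : injective io.
Proof.
move=> [b i] [b' j] e; have := io_old (b, i); rewrite e io_old /= => ij.
move: e; rewrite /io /glue /= ij; case: ifP => [j5|j5].
  rewrite j5 in ij; rewrite /signed => -[e1 e2].
  have [mi mj] : nth (rim 0) F i \in F /\ nth (rim 0) F j \in F by rewrite !mem_nth ?sF.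
  have [e|ne] := eqVneq (nth (rim 0) F i).1 (nth (rim 0) F j).1.
    have : nth (rim 0) F i == nth (rim 0) F j.
      by case: (nth _ F i) (nth _ F j) e e2 => [? ?] [? ?] /= -> ->.
    by rewrite nth_uniq ?sF // => /eqP->; rewrite e in e1; move: e1 => /addIb->.
  have := inv_anti iv F_full mi; rewrite (_ : anti _ = nth (rim 0) F j) ?mj //.
  move: e2 ne; rewrite /anti; case: (nth _ F i) (nth _ F j) => [[] ?] [[] ?] //= ->.
    by [].
  by [].
by case=> -> e; congr pair; move: ij e; rewrite j5; lia.
Qed.

Let io_anti x : io (anti x) = anti (io x).
Proof.
rewrite /io /glue /=; case: ifP => _ //.
by rewrite /signed /anti /=; case: x.1; case: (_.1).
Qed.

Let io_opposite f : map io (opposite f) = opposite (map io f).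
Proof. by rewrite /opposite map_rev -!map_comp; congr rev; apply: eq_map => x /=;
  exact: io_anti. Qed.

Let io_cap : map io cap = F.
Proof.
rewrite -[RHS](mkseq_nth (rim 0)) sF /mkseq /= /io /glue /= /signed /=.
by do 5![case: (nth _ _ _) => ? ?].
Qed.

Let capsE c : c \in caps -> c = cap \/ c = opposite cap.
Proof. by rewrite !inE => /orP[]/eqP; auto. Qed.

Let capsP c : c \in caps -> map io c \in full L.
Proof.
by move=> /capsE[]->; rewrite ?io_opposite io_cap //; exact: full_opposite.
Qed.

Let tube_faces := map (map io) tube.

Let full_attach f : f \in full L' <-> f \in tube_faces \/ (f \in full L /\
  forall c, c \in caps -> f != map io c).
Proof.
have E1 : tube_faces = map (map io) belt ++ map opposite (map (map io) belt).
  by rewrite /tube_faces /tube /full map_cat; congr (_ ++ _).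
have E2 : (forall c, c \in caps -> f != map io c) <-> (f != F) && (f != opposite F).
  split=> [h|/andP[h1 h2] c].
    apply/andP; split; first by rewrite -io_cap h // !inE eqxx.
    by rewrite -io_cap -io_opposite h // !inE eqxx orbT.
  by rewrite !inE => /orP[]/eqP->; rewrite ?io_opposite io_cap.
have mL' : f \in full L' = [|| f \in tube_faces, f \in rest | f \in map opposite rest].
  have -> : L' = map (map io) belt ++ rest by [].
  rewrite E1 /full map_cat !mem_cat.
  by do 4![case: (_ \in _)].
have mL : f \in full L = [|| f == F, f \in rest, f == opposite F | f \in map opposite rest].
  by rewrite /full mem_cat !inE -!orbA.
have := inv_nodup iv; rewrite -/L /full /= mem_cat inE !negb_or => /andP[/and3P[n1 n2 n3]].
rewrite cat_uniq /= negb_or => /and3P[_ /andP[n4 _] /andP[n5 _]].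
rewrite E2 mL' mL; split.
  case/or3P => [->|h|h]; [by left|right|right]; rewrite h !orbT; split=> //;
    apply/andP; split; apply: contraTneq h => -> //.
by case=> [->//|[/or4P[->|->|->|->]]]; rewrite ?andbF ?orbT.
Qed.

Let tube_pent : check_pent 10 tube. Proof. by vm_compute. Qed.
Let caps_pent : check_pent 5 caps. Proof. by vm_compute. Qed.

Let dart_map_io c u v : uniq c -> dart (map io c) (io u) (io v) = dart c u v.
Proof. by move=> Uc; rewrite /dart mem_map // next_map // (inj_eq io_inj). Qed.

Let dart_io c x y : uniq c -> dart (map io c) x y ->
  exists u v, [/\ x = io u, y = io v & dart c u v].
Proof.
move=> Uc d; have [/mapP[u uc xu] /mapP[v vc yv]] := dart_mem d.
by exists u, v; split=> //; rewrite -(dart_map_io _ _ Uc) -xu -yv.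
Qed.

Let tube_faceP f : f \in tube_faces -> exists2 t, t \in tube & f = map io t.
Proof. by move/mapP. Qed.

Let tube_uniq t : t \in tube -> uniq t.
Proof. by move=> /(check_pentP tube_pent)[]. Qed.

Let caps_uniq t : t \in caps -> uniq t.
Proof. by move=> /(check_pentP caps_pent)[]. Qed.

Let tube_face_full t : t \in tube -> map io t \in full L'.
Proof. by move=> tt; apply/full_attach; left; exact: map_f. Qed.

(** Every dart of a removed face is a dart of a face of the tube, so removing
the two faces loses no edge. *)
Let caps_tube c u v : c \in caps -> dart c u v -> exists2 t, t \in tube & dart t u v.
Proof.
have /allP h : all (fun c : seq vlabel => all (fun u => has (fun t =>
  dart t u (next c u)) tube) c) caps.
  by vm_compute.
move=> /h /allP h1 /andP[/h1 /hasP[t tt d] /eqP e]; exists t => //.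
by rewrite -e.
Qed.

Let old_pent f x : f \in full L -> x \in f -> (x.2 < n)%N.
Proof. by move=> /(inv_pent iv)[_ _]; apply. Qed.

Let dart_keep f u v : f \in full L -> dart f u v -> exists2 f', f' \in full L' & dart f' u v.
Proof.
move=> ff d; have [/hasP[c cc /eqP e]|/hasPn h] := boolP (has (fun c => f == map io c) caps).
  rewrite e in d; have [x [y [-> -> d']]] := dart_io (caps_uniq cc) d.
  have [t tt d2] := caps_tube cc d'; exists (map io t); first exact: tube_face_full.
  by rewrite dart_map_io ?tube_uniq.
by exists f => //; apply/full_attach; right.
Qed.

Let removed f := has (fun c => f == map io c) caps.

Let full_split f : f \in full L' -> f \in tube_faces \/ (f \in full L /\ ~~ removed f).
Proof. by move=> /full_attach[|[ff h]]; [left|right; split=> //; apply/hasPn]. Qed.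

Let kept f : f \in full L -> ~~ removed f -> f \in full L'.
Proof. by move=> ff /hasPn h; apply/full_attach; right. Qed.

Let pent_attach f : f \in full L' ->
  [/\ uniq f, size f = 5 & forall x, x \in f -> (x.2 < n + 5)%N].
Proof.
move=> /full_split[/tube_faceP[t tt ->]|[/(inv_pent iv)[h1 h2 h3] _]]; last first.
  by split=> // x /h3; lia.
have [h1 h2 h3] := check_pentP tube_pent tt.
rewrite map_inj_uniq // size_map h2; split=> // _ /mapP[x /h3 x10 ->].
have [x5|x5] := ltnP x.2 5.
  by rewrite (leq_trans _ (leq_addr _ _)) // io_old.
by rewrite /io /glue (leq_gtF x5) /= ltn_add2l ltn_subLR.
Qed.

Let tube_old_dart t u v : t \in tube -> dart t u v -> (u.2 < 5)%N -> (v.2 < 5)%N ->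
  exists2 c, c \in caps & dart c u v.
Proof.
have /allP h : all (fun t : seq vlabel => all (fun u : vlabel =>
    [==> (u.2 < 5)%N, ((next t u).2 < 5)%N => has (fun c => dart c u (next t u)) caps]) t) tube.
  by vm_compute.
move=> /h /allP h1 /andP[/h1 + /eqP e]; rewrite e => + u5 v5; rewrite u5 v5 !implyTb.
by move=> /hasP[c cc d]; exists c.
Qed.

(** A face of the tube has only two vertices on the ends of the tube, those of
one edge of a removed face. *)
Let tube_old_pair t u v : t \in tube -> u \in t -> v \in t -> u != v ->
  (u.2 < 5)%N -> (v.2 < 5)%N ->
  (dart t u v || dart t v u) /\ exists2 c, c \in caps & (u \in c) && (v \in c).
Proof.
have /allP h : all (fun t : seq vlabel => all (fun u : vlabel => all (fun v : vlabel =>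
    [==> u != v, (u.2 < 5)%N, (v.2 < 5)%N => (dart t u v || dart t v u) &&
      has (fun c : seq vlabel => (u \in c) && (v \in c)) caps]) t) t) tube.
  by vm_compute.
move=> /h /allP h1 /h1 /allP h2 /h2 + uv u5 v5; rewrite uv u5 v5 !implyTb.
by move=> /andP[-> /hasP[c cc uvc]]; split=> //; exists c.
Qed.

Let not_removed c f : c \in caps -> ~~ removed f -> map io c = f -> False.
Proof. by move=> cc /hasPn h e; have := h c cc; rewrite e eqxx. Qed.

(** A dart common to the tube and an old face would be one of a removed
face, by which no other old face passes in the same direction. *)
Let orient_tube_old t f u v : t \in tube -> f \in full L -> ~~ removed f ->
  dart (map io t) u v -> dart f u v -> False.
Proof.
move=> tt ff nf d d'; have [uf vf] := dart_mem d'.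
have [x [y [ux vy dt]]] := dart_io (tube_uniq tt) d.
have x5 : (x.2 < 5)%N by rewrite -io_old -ux; exact: old_pent ff uf.
have y5 : (y.2 < 5)%N by rewrite -io_old -vy; exact: old_pent ff vf.
have [c cc dc] := tube_old_dart tt dt x5 y5.
apply: (not_removed cc nf); apply: (inv_orient iv (capsP cc) ff _ d').
by rewrite ux vy dart_map_io ?caps_uniq.
Qed.

Let orient_attach f f' u v : f \in full L' -> f' \in full L' ->
  dart f u v -> dart f' u v -> f = f'.
Proof.
move=> /full_split[/tube_faceP[t tt ->]|[ff nf]] /full_split[/tube_faceP[t' tt' ->]|[ff' nf']] d d'.
- have [x [y [ux vy dt]]] := dart_io (tube_uniq tt) d.
  rewrite ux vy dart_map_io ?tube_uniq // in d'.
  have h : check_orient tube by vm_compute.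
  by rewrite (check_orientP h tt tt' dt d').
- by case: (orient_tube_old tt ff' nf' d d').
- by case: (orient_tube_old tt' ff nf d' d).
- exact: (inv_orient iv ff ff' d d').
Qed.

Let rev_attach f u v : f \in full L' -> dart f u v -> exists2 f', f' \in full L' & dart f' v u.
Proof.
move=> /full_split[/tube_faceP[t tt ->] d|[ff _] d]; last first.
  by have [g gf d'] := inv_rev iv ff d; exact: dart_keep gf d'.
have [x [y [-> -> dt]]] := dart_io (tube_uniq tt) d.
have h : check_rev caps tube by vm_compute.
have [[t' tt' d']|[c cc dc]] := check_revP h tt dt.
  by exists (map io t'); [exact: tube_face_full|rewrite dart_map_io ?tube_uniq].
have [|g gf d'] := inv_rev iv (capsP cc) (u := io x) (v := io y).
  by rewrite dart_map_io ?caps_uniq.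
exact: dart_keep gf d'.
Qed.

(** When a face of the tube and an old face share two vertices, these lie
on a removed face as well, and the claim follows from what was known of the old
face and the removed one. *)
Let meet_attach f f' u v : f \in full L' -> f' \in full L' -> f != f' -> u != v ->
  u \in f -> v \in f -> u \in f' -> v \in f' -> dart f u v || dart f v u.
Proof.
move=> /full_split[/tube_faceP[t tt ->]|[ff nf]] /full_split[/tube_faceP[t' tt' ->]|[ff' nf']] ne uv.
- move=> /mapP[x xt ux] /mapP[y yt vy]; rewrite ux vy in uv *.
  rewrite !mem_map // => xt' yt'; rewrite (inj_eq io_inj) in uv.
  rewrite !dart_map_io ?tube_uniq //.
  have h : check_meet tube by vm_compute.
  apply: (check_meetP h tt tt') => //; by apply: contraNneq ne => ->.
- move=> /mapP[x xt ux] /mapP[y yt vy]; rewrite ux vy in uv *.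
  move=> /(old_pent ff') + /(old_pent ff'); rewrite !io_old => x5 y5.
  rewrite (inj_eq io_inj) in uv; rewrite !dart_map_io ?tube_uniq //.
  by have [] := tube_old_pair tt xt yt uv x5 y5.
- move=> uf vf /mapP[x xt ux] /mapP[y yt vy].
  have x5 : (x.2 < 5)%N by rewrite -io_old -ux; exact: old_pent ff uf.
  have y5 : (y.2 < 5)%N by rewrite -io_old -vy; exact: old_pent ff vf.
  have xy : x != y by apply: contraNneq uv => e; rewrite ux vy e.
  have [_ [c cc /andP[xc yc]]] := tube_old_pair tt' xt yt xy x5 y5.
  apply: (inv_meet iv ff (capsP cc)) => //.
  + by apply/eqP => e; exact: (not_removed cc nf).
  + by rewrite ux map_f.
  + by rewrite vy map_f.
- exact: (inv_meet iv ff ff' ne uv).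
Qed.

Let anti_attach f v : f \in full L' -> v \in f -> anti v \notin f.
Proof.
move=> /full_split[/tube_faceP[t tt ->] /mapP[x xt ->]|[ff _]]; last exact: inv_anti iv _ _ ff.
rewrite -io_anti mem_map //; have h : check_anti tube by vm_compute.
exact: (check_antiP h tt xt).
Qed.

Let new_label (x : vlabel) : (n <= x.2 < n + 5)%N -> exists y, io y = x /\ (5 <= y.2 < 10)%N.
Proof.
case: x => b i /= h; exists (b, i - n + 5)%N; rewrite /io /glue /=.
rewrite ifF; last lia.
by split; [congr pair; lia|lia].
Qed.

Let deg_attach v : (v.2 < n + 5)%N -> exists s : seq vlabel,
  [/\ uniq s, (2 < size s)%N & forall w, w \in s -> exists2 f, f \in full L' & dart f v w].
Proof.
move=> v5; have [vn|vn] := ltnP v.2 n.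
  have [s [Us s2 hs]] := inv_deg iv vn; exists s; split=> // w /hs[f ff d].
  exact: dart_keep ff d.
have [x [<- /andP[x5 x10]]] : exists y, io y = v /\ (5 <= y.2 < 10)%N.
  by apply: new_label; rewrite vn v5.
have /allP h : all (fun x : vlabel => (x.2 < 5)%N || check_deg tube x) (labels_below 10) by vm_compute.
have := h x; rewrite mem_labels_below x10 => /(_ isT); rewrite (leq_gtF x5) orFb.
move=> /check_degP[s [Us s2 hs]]; exists (map io s).
rewrite map_inj_uniq // size_map; split=> // _ /mapP[w /hs[t tt d] ->].
by exists (map io t); [exact: tube_face_full|rewrite dart_map_io ?tube_uniq].
Qed.

(** Old vertices stay connected as no edge is lost, and each new vertex has
an old neighbour. *)
Let conn_attach (P : vlabel -> Prop) :
  (forall f u v, f \in full L' -> dart f u v -> P u -> P v) ->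
  forall u v : vlabel, (u.2 < n + 5)%N -> (v.2 < n + 5)%N -> P u -> P v.
Proof.
move=> cP; have old u v : (u.2 < n)%N -> (v.2 < n)%N -> P u -> P v.
  apply: (inv_conn iv) => f x y ff d.
  by have [g gf d'] := dart_keep ff d; exact: cP gf d'.
have near u : (u.2 < n + 5)%N -> exists2 w : vlabel, (w.2 < n)%N & P u <-> P w.
  move=> u5; have [un|un] := ltnP u.2 n; first by exists u.
  have [x [<- /andP[x5 x10]]] : exists y, io y = u /\ (5 <= y.2 < 10)%N.
    by apply: new_label; rewrite un u5.
  have /allP h : all (fun x : vlabel => (x.2 < 5)%N || has (fun t : seq vlabel =>
      (x \in t) && ((next t x).2 < 5)%N && has (fun t' => dart t' (next t x) x) tube) tube)
    (labels_below 10) by vm_compute.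
  have := h x; rewrite mem_labels_below x10 => /(_ isT); rewrite (leq_gtF x5) orFb.
  move=> /hasP[t tt /andP[/andP[xt y5] /hasP[t' tt' d]]].
  exists (io (next t x)); first by rewrite io_old.
  split; [apply: (cP (map io t))|apply: (cP (map io t'))]; rewrite ?tube_face_full //.
    by rewrite dart_map_io ?tube_uniq // dart_next.
  by rewrite dart_map_io ?tube_uniq.
move=> u v /near[u' u'n [Pu _]] /near[v' v'n [_ Pv]] /Pu Pu'.
exact: Pv (old _ _ u'n v'n Pu').
Qed.

(** A property [P] that spreads around [v] in the new surface spreads in
the old one once a removed face is deemed to have it when the faces of the tube
at [v] have it: these are connected to each other, and they carry the darts of
the removed face. *)
Let link_attach v (P : seq vlabel -> Prop) :
  (forall (f f' : seq vlabel) u, f \in full L' -> f' \in full L' ->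
     dart f u v -> dart f' v u -> P f <-> P f') ->
  forall f f' : seq vlabel, f \in full L' -> f' \in full L' -> v \in f -> v \in f' -> P f ->
    P f'.
Proof.
move=> cP.
have PT t t' : t \in tube -> t' \in tube -> v \in map io t -> v \in map io t' ->
    P (map io t) -> P (map io t').
  move=> tt tt' /mapP[x xt vx]; rewrite vx mem_map // => xt'.
  have h : check_link tube by vm_compute.
  have [->//|[u /orP[]/andP[d d']]] := check_linkP h tt tt' xt xt' (tube_uniq tt).
    have := cP _ _ (io u) (tube_face_full tt) (tube_face_full tt').
    by rewrite vx !dart_map_io ?tube_uniq // => /(_ d d')[].
  have := cP _ _ (io u) (tube_face_full tt') (tube_face_full tt).
  by rewrite vx !dart_map_io ?tube_uniq // => /(_ d' d)[].
pose Q f := if removed f then forall t, t \in tube -> v \in map io t -> P (map io t) else P f.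
have Qcap c t : c \in caps -> t \in tube -> v \in map io t ->
    Q (map io c) <-> P (map io t).
  move=> cc tt vt; rewrite /Q ifT; last by apply/hasP; exists c.
  by split=> [|Pt t' tt' vt']; [exact|exact: PT Pt].
have cQ f f' u : f \in full L -> f' \in full L -> dart f u v -> dart f' v u -> Q f <-> Q f'.
  move=> ff ff' d d'.
  have [rf|rf] := boolP (removed f); have [rf'|rf'] := boolP (removed f').
  - by rewrite /Q rf rf'.
  - move: rf d => /hasP[c cc /eqP ->] /(dart_io (caps_uniq cc))[x [y [ux vy]]].
    move=> /(caps_tube cc)[t tt d].
    have d2 : dart (map io t) u v by rewrite ux vy dart_map_io ?tube_uniq.
    have [_ vt] := dart_mem d2; rewrite (Qcap c t) // /Q (negPf rf').
    exact: cP (tube_face_full tt) (kept ff' rf') d2 d'.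
  - move: rf' d' => /hasP[c cc /eqP ->] /(dart_io (caps_uniq cc))[x [y [ux vy]]].
    move=> /(caps_tube cc)[t tt d'].
    have d2 : dart (map io t) v u by rewrite ux vy dart_map_io ?tube_uniq.
    have [vt _] := dart_mem d2; rewrite (Qcap c t) // /Q (negPf rf).
    exact: cP (kept ff rf) (tube_face_full tt) d d2.
  - by rewrite /Q (negPf rf) (negPf rf'); exact: cP (kept ff rf) (kept ff' rf') d d'.
have lift f : f \in full L' -> v \in f -> (v.2 < n)%N ->
    exists g, [/\ g \in full L, v \in g & Q g <-> P f].
  move=> /full_split[/tube_faceP[t tt ->]|[ff rf]] vf vn; last first.
    by exists f; rewrite /Q (negPf rf).
  have /mapP[x xt vx] := vf; have x5 : (x.2 < 5)%N by rewrite -io_old -vx.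
  have /allP h : all (fun x => has (fun c : seq vlabel =>
    x \in c) caps) (labels_below 5) by vm_compute.
  have := h x; rewrite mem_labels_below => /(_ x5)/hasP[c cc xc].
  exists (map io c); split; [exact: capsP|by rewrite vx map_f|exact: Qcap].
move=> f f' ff ff' vf vf'; have [vn|vn] := ltnP v.2 n.
  have [g [gf vg QP]] := lift f ff vf vn; have [g' [gf' vg' QP']] := lift f' ff' vf' vn.
  by move=> /QP Qg; apply/QP'; exact: (inv_link iv cQ gf gf' vg vg').
case: (full_split ff) vf => [/tube_faceP[t tt ->] vf|[fL _] /(old_pent fL)]; last first.
  by rewrite ltnNge vn.
case: (full_split ff') vf' => [/tube_faceP[t' tt' ->] vf'|[fL _] /(old_pent fL)]; last first.
  by rewrite ltnNge vn.
exact: PT.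
Qed.

(** Every face of the tube contains a new vertex. *)
Let nodup_attach : uniq (full L').
Proof.
have E : perm_eq (full L') (tube_faces ++ full rest).
  have -> : full L' = (map (map io) belt ++ rest) ++
      (map opposite (map (map io) belt) ++ map opposite rest).
    by rewrite /full -map_cat.
  have -> : tube_faces = map (map io) belt ++ map opposite (map (map io) belt).
    by rewrite /tube_faces /tube /full map_cat; congr (_ ++ _).
  by rewrite /full -!catA perm_cat2l perm_catCA.
rewrite (perm_uniq E) cat_uniq; apply/and3P; split.
- by rewrite map_inj_uniq; [vm_compute|exact: inj_map].
- apply/hasPn => f fr; apply/negP => /tube_faceP[t tt e].
  have fL : f \in full L.
    by move: fr; rewrite !mem_cat /= !inE => /orP[]->; rewrite ?orbT.
  have /allP/(_ t tt)/hasP[x xt x5] :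
      all (fun t : seq vlabel => has (fun x : vlabel => (5 <= x.2)%N) t) tube by vm_compute.
  have : io x \in f by rewrite e map_f.
  by move=> /(old_pent fL); rewrite io_old ltnNge x5.
- have := inv_nodup iv; rewrite /full /= => /andP[_].
  by rewrite !cat_uniq /= => /and3P[-> + /andP[_ ->]]; rewrite negb_or => /andP[_ ->].
Qed.

Lemma attach_tube_antipodal : antipodal_surface (n + 5) L'.
Proof.
split.
- exact: nodup_attach.
- exact: pent_attach.
- exact: orient_attach.
- exact: rev_attach.
- exact: link_attach.
- exact: conn_attach.
- exact: meet_attach.
- exact: deg_attach.
- exact: anti_attach.
Qed.

End Attach.

Fixpoint half_faces (g : nat) : seq (seq vlabel) :=
  if g is g'.+1 then attach_tube (5 * g' + 10) (half_faces g') else dodecahedron.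

Lemma size_half_faces g : size (half_faces g) = (4 * g + 6)%N.
Proof.
elim: g => // g IH; rewrite [half_faces g.+1]/=; case: (half_faces g) IH => [|f r] e.
  by move: e => /=; lia.
by move: e; rewrite /attach_tube size_cat size_map /=; lia.
Qed.

Lemma half_faces_antipodal g : antipodal_surface (5 * g + 10) (half_faces g).
Proof.
elim: g => [|g IH]; first exact: dodecahedron_antipodal.
rewrite [half_faces g.+1]/=; have := size_half_faces g.
case: (half_faces g) IH => [|f r] iv; first by move=> /=; lia.
by move=> _; have := attach_tube_antipodal iv;
  rewrite (_ : (5 * g + 10 + 5 = 5 * g.+1 + 10)%N); [|lia].
Qed.

(** * The family as finite pentagonal surfaces *)

Section Family.
Variable g : nat.
Local Notation n := (5 * g + 9).+1.
Let iv : antipodal_surface n (half_faces g).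
Proof. by have := half_faces_antipodal g; rewrite addnS. Qed.

Definition family_vertex := (bool * 'I_n)%type.
Definition family_face := seq_sub (full (half_faces g)).

Definition label (v : family_vertex) : vlabel := (v.1, val v.2).

(** Members of a face are numbered below [n], so [inord] is exact on
them; see [family_cycleK]. *)
Definition family_cycle (f : family_face) : seq family_vertex :=
  [seq (x.1, inord x.2) | x <- val f].

Definition antipode (v : family_vertex) : family_vertex := (~~ v.1, v.2).

Lemma label_inj : injective label.
Proof. by move=> [b i] [b' j] [-> /val_inj ->]. Qed.

Lemma label_onto x : (x.2 < n)%N -> exists v, label v = x.
Proof. by case: x => b i /= i_n; exists (b, Ordinal i_n). Qed.

Lemma family_cycleK f : map label (family_cycle f) = val f.
Proof.
have [_ _ fn] := inv_pent iv (valP f).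
rewrite -map_comp map_id_in // => x /fn xn; rewrite /label /= inordK //.
by case: (x).
Qed.

Lemma family_uniq f : uniq (family_cycle f).
Proof.
by rewrite -(map_inj_uniq label_inj) family_cycleK; case: (inv_pent iv (valP f)).
Qed.

Lemma mem_family f v : (v \in family_cycle f) = (label v \in val f).
Proof. by rewrite -family_cycleK mem_map //; exact: label_inj. Qed.

Lemma dart_family f u v : dart (family_cycle f) u v = dart (val f) (label u) (label v).
Proof.
rewrite -[in RHS]family_cycleK /dart mem_map; last exact: label_inj.
by rewrite next_map ?family_uniq ?(inj_eq label_inj) //; exact: label_inj.
Qed.

Lemma label_dart f x y : f \in full (half_faces g) -> dart f x y ->
  exists u v, x = label u /\ y = label v.
Proof.
move=> ff d; have [_ _ fn] := inv_pent iv ff; have [xf yf] := dart_mem d.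
have [u <-] := label_onto (fn _ xf); have [v <-] := label_onto (fn _ yf).
by exists u, v.
Qed.

Lemma family_surface : pentagonal_surface family_cycle.
Proof.
have deg v : exists s : seq family_vertex,
    [/\ uniq s, (2 < size s)%N & forall w, w \in s -> exists f, dart (family_cycle f) v w].
  have [s [Us s2 hs]] := inv_deg iv (ltn_ord v.2 : ((label v).2 < n)%N).
  exists [seq (x.1, inord x.2) | x <- s].
  have sK : map label [seq (x.1, inord x.2) | x <- s] = s.
    rewrite -map_comp map_id_in // => x /hs[f ff /dart_mem[_ xf]].
    have [_ _ /(_ _ xf) xn] := inv_pent iv ff.
    by rewrite /label /= inordK //; case: (x).
  rewrite -(map_inj_uniq label_inj) sK size_map; split=> // w ws.
  have /hs[f ff d] : label w \in s by rewrite -sK map_f.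
  by exists (SeqSub ff); rewrite dart_family.
split.
- exact: family_uniq.
- by move=> f; rewrite size_map; case: (inv_pent iv (valP f)).
- move=> f f' u v; rewrite !dart_family => d d'; apply: val_inj.
  exact: (inv_orient iv (valP f) (valP f') d d').
- move=> f u v; rewrite dart_family => d.
  by have [f' ff' d'] := inv_rev iv (valP f) d; exists (SeqSub ff'); rewrite dart_family.
- move=> v P cP f f'; rewrite !mem_family => vf vf' Pf.
  pose Q (h : seq vlabel) := forall f, val f = h -> P f.
  have : Q (val f').
    apply: (inv_link iv (v := label v) (P := Q) _ (valP f) (valP f') vf vf'); last first.
      by move=> f1 /val_inj->.
    move=> h h' u hf hf' d d'; have [u' [_ [eu _]]] := label_dart hf d.
    have c : P (SeqSub hf) <-> P (SeqSub hf').
      by apply: (cP _ _ u'); rewrite dart_family -eu.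
    split=> [Qh f1 e|Qh f1 e].
      rewrite (_ : f1 = SeqSub hf'); last exact: val_inj.
      by apply/c; exact: Qh.
    rewrite (_ : f1 = SeqSub hf); last exact: val_inj.
    by apply/c; exact: Qh.
  exact.
- move=> P cP u v Pu; pose Q x := forall w, label w = x -> P w.
  have : Q (label v).
    apply: (inv_conn iv (P := Q) _ (ltn_ord u.2 : ((label u).2 < n)%N)
      (ltn_ord v.2 : ((label v).2 < n)%N)); last by move=> w /label_inj ->.
    move=> f x y ff d Qx w ew; have [u' [v' [eu ev]]] := label_dart ff d.
    apply: (cP (SeqSub ff) u'); last exact: Qx.
    by rewrite dart_family -eu ew.
  exact.
- move=> f f' u v ne uv; rewrite !mem_family !dart_family.
  by apply: (inv_meet iv (valP f) (valP f')); rewrite ?(inj_eq val_inj) ?(inj_eq label_inj).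
- move=> v; have [s [Us s2 hs]] := deg v.
  apply: (leq_trans s2); rewrite -(card_uniqP Us); apply/subset_leq_card/fintype.subsetP.
  by move=> w /hs[f d]; rewrite inE; apply/existsP; exists f.
Qed.

Lemma card_family_face : #|{: family_face}| = (8 * g + 12)%N.
Proof.
rewrite card_seq_sub; last exact: inv_nodup iv.
by rewrite size_cat size_map size_half_faces; lia.
Qed.

Lemma card_family_vertex : #|{: family_vertex}| = (10 * g + 20)%N.
Proof. by rewrite card_prod card_bool card_ord; lia. Qed.

Lemma antipodeK : involutive antipode.
Proof. by case=> b i; rewrite /antipode /= negbK. Qed.

Lemma label_antipode v : label (antipode v) = anti (label v).
Proof. by []. Qed.

Lemma dart_opposite f u v : uniq f -> dart (opposite f) (anti v) (anti u) = dart f u v.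
Proof.
move=> Uf; have anti_inj := inv_inj antiK.
rewrite /dart mem_opposite antiK /opposite next_rev ?map_inj_uniq //.
rewrite prev_map // (inj_eq anti_inj).
apply/andP/andP => [[vf /eqP e]|[uf /eqP <-]].
  by rewrite -e mem_prev vf next_prev.
by rewrite mem_next uf prev_next ?eqxx.
Qed.

Lemma family_antipodal f : exists f' : family_face, forall u v,
  dart (family_cycle f') (antipode v) (antipode u) = dart (family_cycle f) u v.
Proof.
exists (SeqSub (full_opposite (valP f))) => u v; rewrite !dart_family !label_antipode.
by rewrite dart_opposite //; case: (inv_pent iv (valP f)).
Qed.

Lemma family_free f v : v \in family_cycle f -> antipode v \notin family_cycle f.
Proof. by rewrite !mem_family label_antipode; exact: (inv_anti iv (valP f)). Qed.

Lemma family_nonempty : family_face.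
Proof.
have /card_gt0P/sigW[f _] : (0 < #|{: family_face}|)%N by rewrite card_family_face; lia.
exact: f.
Qed.

End Family.

Theorem theorem1p3 (R : realType) (g : nat) :
  exists S : topologicalType,
    [/\ is_surface R S, orientable_of_genus R S g
      & exists M : graph_embedding R S,
          [/\ centrally_symmetric M, #|gvertex M| = (10 * g + 20)%N
            & all_faces_pentagons M]].
Proof.
have ps := family_surface g.
exists (realization R (cone_complex (@family_cycle g))); split.
- exact: (cone_map_surface R ps (family_nonempty g)).
- exists (cone_map R ps); split.
  + exact: cone_map_is_map.
  + exact: cone_map_orientable.
  + have := @cone_map_euler R _ _ _ ps (20 * g + 30)%N.
    (* 10 g + 20 vertices, 20 g + 30 edges and 8 g + 12 faces. *)
    rewrite card_family_face card_family_vertex => /(_ ltac:(lia)).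
    by rewrite (_ : _ + _ = 2 - (2 * g)%N%:Z) //; lia.
- exists (cone_map R ps); split.
  + apply: (@cone_map_symmetric R _ _ _ ps (@antipode g)).
    * exact: antipodeK.
    * exact: family_antipodal.
    * exact: family_free.
  + exact: card_family_vertex.
  + exact: cone_map_pentagons.
Qed.
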